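(* Let $\mathfrak g$ be a symmetrizable Kac–Moody algebra over $\mathbb C$ with Cartan matrix $(a_{st})_{s,t\in\Delta}$, $\Delta$ finite. Let $I\subset\Delta$ be a subset such that $a_{ij}\in\{0,-1\}$ for all $i\neq j$ in $I$ and such that $I$, regarded as a full subgraph of the Dynkin diagram, has no cycle of length $\ge 3$. Let $\mathcal R$ be a choice of a root vertex in each connected component of $I$. Let $D$ be a subset of $I$ such that the weight $$\lambda_{D,I}=2\rho-\sum_{i\in I}\alpha_i-\sum_{d\in D}\alpha_d$$ is dominant. Then the element $$\pi_{D,I}(\mathcal R)=f_D^{\nearrow}(\mathcal R)\,f_I^{\searrow}(\mathcal R)\,\pi_\rho$$ of $B(\rho)\cup\{0\}$ is non-zero, has weight $\lambda_{D,I}-\rho$, and is $\rho$-dominant.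
   Context: The simple roots are $\alpha_s$ and the simple coroots $\alpha_s^\vee$ ($s\in\Delta$). $\rho\in\mathfrak h^*$ is a fixed weight with $\langle\rho,\alpha_s^\vee\rangle=1$ for all $s\in\Delta$. A weight $\lambda\in\mathfrak h^*$ is dominant (integral) if $\langle\lambda,\alpha_s^\vee\rangle\in\mathbb N$ for all $s\in\Delta$. $B(\rho)$ is the (Kashiwara) crystal of the irreducible integrable highest weight module with highest weight $\rho$, $\pi_\rho$ is its element of weight $\rho$, $f_s,e_s$ ($s\in\Delta$) are the lowering and raising crystal operators, and $\varepsilon_s(x)=\max\{n: e_s^n x\ne 0\}$. A non-zero element $x\in B(\rho)$ is called $\rho$-dominant if $\mathrm{wt}(x)+\rho$ is dominant and $\varepsilon_s(x)\le 1$ for all $s\in\Delta$. The hypotheses on $I$ imply that every connected component of $I$ is a tree. Given the choice $\mathcal R$ of a root in each component, orient all edges towards the root of their component; write $x\to y$ for an oriented edge from $x$ to $y$. Put $N=|I|$ and choose a numbering $i_1,\dots,i_N$ of the elements of $I$ such that $i_k\to i_\ell$ implies $k>\ell$. Define $$f_I^{\searrow}(\mathcal R)=f_{i_N}\cdots f_{i_1}$$ (product in decreasing order of the indices from left to right) and $$f_D^{\nearrow}(\mathcal R)=\prod_{d\in D}f_d$$ with the product taken in increasing order of the indices from left to right (e.g. if $D=\{i_1,i_3\}$ then $f_D^{\nearrow}=f_{i_1}f_{i_3}$). These products depend only on $\mathcal R$, not on the numbering, because $f_s$ and $f_t$ commute when $s\ne t$ are not neighbours in the Dynkin diagram. *)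

(* Defs.v *)
From HB Require Import structures.
From mathcomp Require Import all_boot all_order all_algebra.
From mathcomp Require Import fraction reals complex.

Set Implicit Arguments.
Unset Strict Implicit.
Unset Printing Implicit Defensive.
Import Order.TTheory GRing.Theory Num.Theory.
Local Open Scope ring_scope.

(** * Cartan data *)

Definition is_gcm (Delta : finType) (A : Delta -> Delta -> int) : Prop :=
  [/\ forall s, A s s = 2,
      forall s t, s != t -> A s t <= 0
    & forall s t, A s t = 0 -> A t s = 0].

(* The matrix diag(d) A is symmetric.  A positive rational symmetrizer of an
   integral matrix can be rescaled to positive integers, as is needed to form
   q_s = q ^ d_s inside Q(q). *)
Definition is_symmetrizer (Delta : finType) (A : Delta -> Delta -> int)
    (d : Delta -> nat) : Prop :=
  (forall s, (0 < d s)%N) /\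
  (forall s t, (d s)%:Z * A s t = (d t)%:Z * A t s).

Definition gcm_mx (K : nzRingType) (Delta : finType)
    (A : Delta -> Delta -> int) : 'M[K]_#|Delta| :=
  \matrix_(i, j) (A (enum_val i) (enum_val j))%:~R.

(* Minimal realization of A over the complex numbers R[i]. *)
Record realization (R : realType) (Delta : finType)
    (A : Delta -> Delta -> int) := Realization {
  cartan :> vectType R[i];
  simple_coroot : Delta -> cartan;
  simple_root : Delta -> 'Hom(cartan, R[i]^o);
  simple_coroot_free : free [seq simple_coroot s | s <- enum Delta];
  simple_root_free : free [seq simple_root s | s <- enum Delta];
  simple_root_coroot : forall s t,
    simple_root t (simple_coroot s) = (A s t)%:~R;
  cartan_dim :
    (\dim {: cartan} + \rank (gcm_mx R[i] A) = 2 * #|Delta|)%N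
}.

Notation weight h := 'Hom(cartan h, _^o).

Definition dominant (R : realType) (Delta : finType)
    (A : Delta -> Delta -> int) (h : realization R A) (lam : weight h) : Prop :=
  forall s, exists n : nat, lam (simple_coroot h s) = n%:R.

(** * The field Q(q) and its subring of functions regular at q = 0 *)

Notation Qq := {fraction {poly rat}}.

Definition qvar : Qq := tofrac 'X.

Definition qconst (c : rat) : Qq := tofrac c%:P.

Definition regular_at0 (x : Qq) : Prop :=
  exists p r : {poly rat}, r.[0] != 0 /\ x = tofrac p / tofrac r.

Definition qint (n : int) (x : Qq) : Qq := (x ^ n - x ^ (- n)) / (x - x^-1).

Definition qfact (n : nat) (x : Qq) : Qq := \prod_(1 <= k < n.+1) qint k x.

(** * Weight modules over the quantized enveloping algebra U_q(g)

    The Kac-Moody algebra g of A enters through its minimal realization and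
    U_q(g).  B(rho) is the crystal base of the U_q(g)-module that deforms the
    irreducible integrable g-module of highest weight rho. *)

Section QuantumGroup.

Variables (R : realType) (Delta : finType) (A : Delta -> Delta -> int).
Variables (d : Delta -> nat) (h : realization R A).

Definition qs (s : Delta) : Qq := qvar ^+ d s.

Definition divpow (V : lmodType Qq) (X : Delta -> V -> V)
    (s : Delta) (n : nat) (v : V) : V :=
  (qfact n (qs s))^-1 *: iter n (X s) v.

Definition serre (V : lmodType Qq) (X : Delta -> V -> V) : Prop :=
  forall s t, s != t -> forall v,
    let m := `|1 - A s t|%N in
    \sum_(k < m.+1)
       (-1) ^+ k *: divpow X s k (X t (divpow X s (m - k)%N v)) = 0.

(* The part q^H of U_q(g) is not restricted to a lattice of H's: its action is
   encoded by a grading of V by weights in h^* that are integral on the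
   coroots, [wproj mu] being the projection of V onto its summand V_mu.
   [Kop s] is the action of K_s = q^(d_s alpha_s^vee). *)
Record Uq_module := UqModule {
  carrier :> lmodType Qq;
  wproj : weight h -> {linear carrier -> carrier};
  Eop : Delta -> {linear carrier -> carrier};
  Fop : Delta -> {linear carrier -> carrier};
  Kop : Delta -> {linear carrier -> carrier};
  Kinv : Delta -> {linear carrier -> carrier};
  wprojE : forall mu nu v,
    wproj mu (wproj nu v) = if mu == nu then wproj nu v else 0;
  wproj_sum : forall v, exists2 ws : seq (weight h),
    uniq ws & v = \sum_(mu <- ws) wproj mu v;
  wproj_integral : forall (mu : weight h) v, wproj mu v != 0 ->
    forall s, exists m : int, mu (simple_coroot h s) = m%:~R;
  Eop_weight : forall s mu v,
    Eop s (wproj mu v) = wproj (mu + simple_root h s) (Eop s v);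
  Fop_weight : forall s mu v,
    Fop s (wproj mu v) = wproj (mu - simple_root h s) (Fop s v);
  Kop_weight : forall s (mu : weight h) (m : int) v,
    mu (simple_coroot h s) = m%:~R ->
    Kop s (wproj mu v) = qs s ^ m *: wproj mu v;
  KopK : forall s, cancel (Kop s) (Kinv s);
  KinvK : forall s, cancel (Kinv s) (Kop s);
  EF_comm : forall s t v,
    Eop s (Fop t v) - Fop t (Eop s v) =
      if s == t then (qs s - (qs s)^-1)^-1 *: (Kop s v - Kinv s v) else 0;
  Eop_serre : serre (fun s => Eop s);
  Fop_serre : serre (fun s => Fop s)
}.

Variable M : Uq_module.

Definition has_weight (mu : weight h) (v : M) : Prop := wproj M mu v = v.

Definition integrable : Prop :=
  forall s (v : M), exists n,
    iter n (Eop M s) v = 0 /\ iter n (Fop M s) v = 0.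

(* Stability under K_s and K_s^-1 follows from stability under the
   projections to the weight spaces. *)
Definition is_submodule (W : M -> Prop) : Prop :=
  [/\ W 0,
      forall (c : Qq) v w, W v -> W w -> W (c *: v + w),
      forall mu v, W v -> W (wproj M mu v),
      forall s v, W v -> W (Eop M s v)
    & forall s v, W v -> W (Fop M s v)].

Definition irreducible_module : Prop :=
  (exists v : M, v != 0) /\
  forall W, is_submodule W -> (forall v, W v -> v = 0) \/ (forall v, W v).

(* When M is irreducible it is generated by u. *)
Definition highest_weight (lam : weight h) : Prop :=
  exists u : M, [/\ u != 0, has_weight lam u & forall s, Eop M s u = 0].

(** ** Kashiwara operators *)

(* u = \sum_n F_s^(n) u_n with u_n in Ker E_s of weight mu + n alpha_s, and
   u_n = 0 unless 0 <= n <= <mu + n alpha_s, alpha_s^vee>. *)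
Definition string_dec (s : Delta) (mu : weight h)
    (N : nat) (u_ : nat -> M) (u : M) : Prop :=
  [/\ forall n, Eop M s (u_ n) = 0,
      forall n, has_weight (mu + simple_root h s *+ n) (u_ n),
      forall n, u_ n != 0 ->
        exists2 m : nat, (n <= m)%N &
          (mu + simple_root h s *+ n : weight h) (simple_coroot h s) = m%:R
    & u = \sum_(0 <= n < N) divpow (fun t => Fop M t) s n (u_ n)].

Definition kashiwaraF (s : Delta) (u v : M) : Prop :=
  exists mu N u_, string_dec s mu N u_ u /\
    v = \sum_(0 <= n < N) divpow (fun t => Fop M t) s n.+1 (u_ n).

Definition kashiwaraE (s : Delta) (u v : M) : Prop :=
  exists mu N u_, string_dec s mu N u_ u /\
    v = \sum_(1 <= n < N) divpow (fun t => Fop M t) s n.-1 (u_ n).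

(** ** Crystal bases *)

Definition lin_comb (J : choiceType) (e : J -> M) (S : Qq -> Prop) (v : M) :=
  exists (js : seq J) (c : J -> Qq),
    (forall j, S (c j)) /\ v = \sum_(j <- js) c j *: e j.

Definition lin_indep (J : choiceType) (e : J -> M) : Prop :=
  forall (js : seq J) (c : J -> Qq), uniq js ->
    \sum_(j <- js) c j *: e j = 0 -> forall j, j \in js -> c j = 0.

(* L is free over the ring of functions regular at 0, and Q(q) (x) L = M:
   L has a basis that is also a Q(q)-basis of M. *)
Definition is_lattice (L : M -> Prop) : Prop :=
  exists (J : choiceType) (e : J -> M),
    [/\ lin_indep e, forall v, lin_comb e (fun=> True) v
      & forall v, L v <-> lin_comb e regular_at0 v].

Definition in_qL (L : M -> Prop) (v : M) : Prop :=
  exists2 w, L w & v = qvar *: w.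

(* The class mod qL of the vector v is the element x of B u {0}, where
   elements of B are given by representatives in L. *)
Definition represents (L : M -> Prop) (B : Type) (rep : B -> M)
    (x : option B) (v : M) : Prop :=
  in_qL L (v - oapp rep 0 x).

(* A (lower) crystal base (L, B) at q = 0.  The elements of B, a basis of L/qL, are given
   through homogeneous representatives [rep b] in L, and [None] stands for 0
   in B u {0}. *)
Record crystal_base := CrystalBase {
  lattice : M -> Prop;
  crystal :> choiceType;
  rep : crystal -> M;
  wt : crystal -> weight h;
  ftil : Delta -> crystal -> option crystal;
  etil : Delta -> crystal -> option crystal;
  lattice_free : is_lattice lattice;
  lattice_weight : forall mu v, lattice v -> lattice (wproj M mu v);
  lattice_F : forall s u v, lattice u -> kashiwaraF s u v -> lattice v;
  lattice_E : forall s u v, lattice u -> kashiwaraE s u v -> lattice v;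
  rep_lattice : forall b, lattice (rep b);
  rep_weight : forall b, has_weight (wt b) (rep b);
  rep_span : forall v, lattice v ->
    exists (bs : seq crystal) (c : crystal -> rat),
      in_qL lattice (v - \sum_(b <- bs) qconst (c b) *: rep b);
  rep_indep : forall (bs : seq crystal) (c : crystal -> rat), uniq bs ->
    in_qL lattice (\sum_(b <- bs) qconst (c b) *: rep b) ->
    forall b, b \in bs -> c b = 0;
  ftilP : forall s b, exists2 v,
    kashiwaraF s (rep b) v & represents lattice rep (ftil s b) v;
  etilP : forall s b, exists2 v,
    kashiwaraE s (rep b) v & represents lattice rep (etil s b) v;
  ftil_etil : forall s b b', ftil s b = Some b' <-> etil s b' = Some b
}.

Variable B : crystal_base.

(* The operators on B u {0}. *)
Definition f_ (s : Delta) (x : option B) : option B := obind (ftil s) x.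
Definition e_ (s : Delta) (x : option B) : option B := obind (etil s) x.

(* f_{s_1} ... f_{s_k} x for the word w = [:: s_1; ...; s_k]. *)
Definition f_word (w : seq Delta) (x : option B) : option B := foldr f_ x w.

Definition epsilon_is (s : Delta) (b : B) (n : nat) : Prop :=
  iter n (e_ s) (Some b) <> None /\
  forall m, iter m (e_ s) (Some b) <> None -> (m <= n)%N.

Definition rho_dominant (rho : weight h) (b : B) : Prop :=
  dominant (wt b + rho) /\
  forall s, exists2 n, epsilon_is s b n & (n <= 1)%N.

End QuantumGroup.

(** * Rooted forests in the Dynkin diagram *)

Section Forest.

Variables (Delta : finType) (A : Delta -> Delta -> int) (I : {set Delta}).

Definition adj : rel Delta :=
  fun s t => [&& s \in I, t \in I, s != t & A s t != 0].

Definition no_cycle : Prop :=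
  forall c : seq Delta, (3 <= size c)%N -> ~ ucycle adj c.

Definition root_choice (Rt : {set Delta}) : Prop :=
  Rt \subset I /\
  forall i, i \in I -> #|[set r in Rt | connect adj i r]| = 1%N.

(* x -> y: the simple path from x to the root of its component starts with
   the edge x - y. *)
Definition towards_root (Rt : {set Delta}) (x y : Delta) : Prop :=
  exists p : seq Delta,
    [/\ path adj x (y :: p), uniq (x :: y :: p) & last y p \in Rt].

(* num = [:: i_1; ...; i_N], and x -> y implies that y comes before x. *)
Definition numbering (Rt : {set Delta}) (num : seq Delta) : Prop :=
  [/\ uniq num, num =i I
    & forall x y, towards_root Rt x y -> (index y num < index x num)%N].

End Forest.

(* Main.v *)
(** All vectors that matter lie in weight spaces rho - \sum_s c_s alpha_s of the
    module V with c_s <= 2.  If c_s = 0, the weight space is killed by E_s and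
    its weight has a positive pairing m with alpha_s^vee.  Hence for c_s <= 2
    the components of the s-string decomposition of v are explicit multiples of
    powers of E_s applied to v (for c_s = 1 the top one is E_s v / [m]), and for
    c_t = 1 the Kashiwara operator of t sends v = v_0 + F_t v_1 to
    F_t v - ([2] - 1) F_t^(2) v_1.  Since E_s commutes with F_t, the effect of
    f_t on epsilon_s is governed by quotients such as [m] / [m + 1], which
    vanish at q = 0.  For a_st = -1 and b of weight rho - \sum_s c_s alpha_s:
    - if c_s = 1 and c_t = 0, then epsilon_s (f_t b) = 0;
    - if c_s = c_t = 1 and epsilon_s b = 0, then epsilon_s (f_t b) = 0;
    - if c_s = 2 and c_t = 1, then epsilon_s (f_t b) <= 1.
    For a_st = 0 the operators of s and t commute.

    Let s be in D.  If some neighbour of s comes after s in the numbering, the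
    first two facts give epsilon_s = 0 just before the second f_s is applied, so
    epsilon_s <= 1 afterwards, and this persists.  If not, some neighbour of s
    lies in D and comes before s: otherwise dominance of lambda would give s two
    neighbours that precede it, that is, two parents.  The third fact, applied
    at that neighbour, again gives epsilon_s <= 1.

    The second f_s never gives 0: by dominance the pairing of the current weight
    with alpha_s^vee is positive, unless s has no later neighbour and the pairing
    is 0.  In that case the first f_s commutes to the left of all later factors,
    and f_s^2 is applied to an element whose pairing is 2. *)

Require Import Defs.
From HB Require Import structures.
From mathcomp Require Import all_boot all_order all_algebra.
From mathcomp Require Import fraction reals complex.
From mathcomp Require Import ring zify.
From mathcomp Require boolp.
Set Implicit Arguments.
Unset Strict Implicit.
Unset Printing Implicit Defensive.
Import Order.TTheory GRing.Theory Num.Theory.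
Local Open Scope ring_scope.

(** * Quantum integers at q = 0 *)

Section QuantumNumbers.

Variables (F : fieldType) (x : F).
Hypotheses (x_neq0 : x != 0) (xX_neq1 : forall k, (0 < k)%N -> x ^+ k != 1).

(** The quantum integer [n] over an abstract field in which x has infinite order. It is specialized
    below to x = q_s in Q(q). *)
Definition qnum (n : int) : F := (x ^ n - x ^ (- n)) / (x - x^-1).

Lemma qnum_sqr_neq1 : x ^+ 2 - 1 != 0.
Proof. by rewrite subr_eq0 xX_neq1. Qed.

Lemma qnum_denom_neq0 : x - x^-1 != 0.
Proof.
have -> : x - x^-1 = (x ^+ 2 - 1) / x by field.
by rewrite mulf_neq0 ?invr_eq0 ?qnum_sqr_neq1.
Qed.

Lemma qnum1 : qnum 1 = 1.
Proof. by rewrite /qnum divff ?qnum_denom_neq0. Qed.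

Lemma qnumN n : qnum (- n) = - qnum n.
Proof. by rewrite /qnum opprK -mulNr opprB. Qed.

(** For n > 0 this separates the pole x^(1-n) of [n] at x = 0 from a polynomial in x^2 with constant
    term 1. The orders of all quotients at 0 are read off from it. *)
Lemma qnum_nat (n : nat) : qnum n = x * x ^- n * \sum_(j < n) (x ^+ 2) ^+ j.
Proof.
have h1 : (x ^+ 2 - 1) * (\sum_(j < n) (x ^+ 2) ^+ j) = x ^+ n * x ^+ n - 1.
  by rewrite -subrX1 -exprM mulnC exprM expr2.
have hx2 := qnum_sqr_neq1.
have -> : \sum_(j < n) (x ^+ 2) ^+ j = (x ^+ n * x ^+ n - 1) / (x ^+ 2 - 1).
  by rewrite -h1; field.
rewrite /qnum -exprnN -exprnP.
have : x ^+ n != 0 by rewrite expf_neq0.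
by move: (x ^+ n) => X hX; field; rewrite hX x_neq0 hx2.
Qed.

Lemma qnum_neq0 n : n != 0 -> qnum n != 0.
Proof.
have pos (k : nat) : (0 < k)%N -> qnum k != 0.
  move=> k0; rewrite /qnum mulf_neq0 ?invr_eq0 ?qnum_denom_neq0 // -exprnN -exprnP.
  have -> : x ^+ k - x ^- k = (x ^+ (k + k) - 1) / x ^+ k.
    by rewrite exprD; field; rewrite expf_neq0.
  by rewrite mulf_neq0 ?invr_eq0 ?expf_neq0 // subr_eq0 xX_neq1 // addn_gt0 k0.
case: n => [[|k]|k] // _; first exact: pos.
by rewrite NegzE qnumN oppr_eq0 pos.
Qed.

(** The induction step for E F^(n+1) v = [n+1] [m-n] F^n v, where E v = 0 and v has pairing m. *)
Lemma qnum_rec (m n : int) :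
  qnum n * qnum (m - n + 1) + qnum (m - n *+ 2) = qnum (n + 1) * qnum (m - n).
Proof.
have ux : x \is a GRing.unit by rewrite unitfE.
rewrite /qnum !mulr2n !opprD !opprK !exprzDr // -!invr_expz !expr1z.
have hX : x ^ m != 0 by rewrite expfz_neq0.
have hN : x ^ n != 0 by rewrite expfz_neq0.
move: (x ^ m) (x ^ n) hX hN => X N hX hN.
by field; rewrite qnum_sqr_neq1 hX hN x_neq0.
Qed.

Lemma qnum_ratio (a b : nat) : (a <= b)%N -> (0 < b)%N ->
  qnum a / qnum b = x ^+ (b - a) *
    ((\sum_(j < a) (x ^+ 2) ^+ j) / (\sum_(j < b) (x ^+ 2) ^+ j)).
Proof.
move=> ab b0.
have hb : \sum_(j < b) (x ^+ 2) ^+ j != 0.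
  have := @qnum_neq0 b%:Z; rewrite qnum_nat => h.
  apply: contraTneq (h _) => [->|]; first by rewrite mulr0 eqxx.
  by rewrite -lt0n.
rewrite !qnum_nat expfB_cond ?(negbTE x_neq0) ?add0n //.
have : x ^+ a != 0 by rewrite expf_neq0.
have : x ^+ b != 0 by rewrite expf_neq0.
move: (x ^+ a) (x ^+ b) hb => Xa Xb hb hb' ha.
by field; rewrite ha hb' hb x_neq0.
Qed.

Lemma qnum2 : qnum 2 = x^-1 * (x ^+ 2 + 1).
Proof.
rewrite /qnum -exprnN -exprnP; have hx2 := qnum_sqr_neq1.
by field; rewrite hx2 x_neq0.
Qed.

End QuantumNumbers.

(** Solves for a vector of which E_s^2 yields only a multiple, with the scalars grouped into
    quotients of quantum integers whose order at 0 is known. *)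
Lemma scaled_difference_solve (K : fieldType) (W : lmodType K) (a N2 N1 N M : K) (x f D : W) :
  N2 != 0 -> N1 != 0 ->
  (N2 * N1) *: x = (N1 * N) *: f - ((a - 1) * (N * M)) *: D ->
  x = (N / N2) *: f - ((a * (N / N2) - N / N2) * (M / N1)) *: D.
Proof.
move=> h2 h1 e; have -> : x = (N2 * N1)^-1 *: ((N2 * N1) *: x).
  by rewrite scalerA mulVf ?scale1r // mulf_neq0.
rewrite e scalerBr !scalerA; congr (_ *: _ - _ *: _); field; rewrite ?h1 ?h2 //.
Qed.

(** This and the next two identities regroup scalars into the quotients estimated below. *)
Lemma mulr_ratio (K : comNzRingType) (i b q : K) : i * b * q = q * (b * i).
Proof. ring. Qed.

Lemma mulr_subr1_ratio (K : comNzRingType) (i a n : K) :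
  i * ((a - 1) * n) = a * (n * i) - n * i.
Proof. ring. Qed.

Lemma mulr_regroup (K : comNzRingType) (a q y N z : K) :
  a * (q * y * N * z) = q * (a * (N * z) * y).
Proof. ring. Qed.

(** * Functions regular or vanishing at q = 0 *)

Section RegularAtZero.

Lemma tofrac_neq0 (r : {poly rat}) : r.[0] != 0 -> tofrac r != 0.
Proof. by rewrite tofrac_eq0; apply: contraNneq => ->; rewrite horner0. Qed.

Lemma regular_frac (p r : {poly rat}) :
  r.[0] != 0 -> regular_at0 (tofrac p / tofrac r).
Proof. by move=> r0; exists p, r. Qed.

Lemma regular_poly (p : {poly rat}) : regular_at0 (tofrac p).
Proof. by exists p, 1; rewrite hornerC oner_eq0 tofrac1 divr1. Qed.

Lemma regular0 : regular_at0 0.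
Proof. by rewrite -[0]tofrac0; apply: regular_poly. Qed.

Lemma regular1 : regular_at0 1.
Proof. by rewrite -[1]tofrac1; apply: regular_poly. Qed.

Lemma regularM x y : regular_at0 x -> regular_at0 y -> regular_at0 (x * y).
Proof.
move=> [p [r [r0 ->]]] [p' [r' [r'0 ->]]]; exists (p * p'), (r * r').
by rewrite hornerM mulf_neq0 // !tofracM mulf_div.
Qed.

Lemma regularD x y : regular_at0 x -> regular_at0 y -> regular_at0 (x + y).
Proof.
move=> [p [r [r0 ->]]] [p' [r' [r'0 ->]]]; exists (p * r' + p' * r), (r * r').
by rewrite hornerM mulf_neq0 // tofracD !tofracM addf_div ?tofrac_neq0.
Qed.

Lemma regularN x : regular_at0 x -> regular_at0 (- x).
Proof.
by move=> [p [r [r0 ->]]]; exists (- p), r; rewrite tofracN mulNr.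
Qed.

Lemma regularMn x n : regular_at0 x -> regular_at0 (x *+ n).
Proof.
move=> hx; elim: n => [|n IHn]; first exact: regular0.
by rewrite mulrS; apply: regularD.
Qed.

Lemma regularX n : regular_at0 (qvar ^+ n).
Proof. by rewrite /qvar -tofracXn; apply: regular_poly. Qed.

Lemma regular_qvar : regular_at0 qvar.
Proof. by rewrite -[qvar]expr1; apply: regularX. Qed.

(** The maximal ideal of the local ring of functions regular at 0. *)
Definition vanishes_at0 (x : Qq) : Prop := exists2 y, regular_at0 y & x = qvar * y.

Lemma vanishes_regular x : vanishes_at0 x -> regular_at0 x.
Proof. by move=> [y ry ->]; apply: regularM => //; apply: regular_qvar. Qed.

Lemma vanishesB x y : vanishes_at0 x -> vanishes_at0 y -> vanishes_at0 (x - y).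
Proof.
move=> [x' rx ->] [y' ry ->]; exists (x' - y'); last by rewrite mulrBr.
exact/regularD/regularN.
Qed.

Lemma vanishesM x y : vanishes_at0 x -> regular_at0 y -> vanishes_at0 (x * y).
Proof. by move=> [x' rx ->] ry; exists (x' * y); [apply: regularM|rewrite mulrA]. Qed.

Lemma vanishes_qvar x : regular_at0 x -> vanishes_at0 (qvar * x).
Proof. by exists x. Qed.

Lemma qvar_neq0 : qvar != 0.
Proof. by rewrite /qvar tofrac_eq0 polyX_eq0. Qed.

Lemma qvarX_neq1 n : (0 < n)%N -> qvar ^+ n != 1.
Proof.
move=> n0; rewrite /qvar -tofracXn -[1]tofrac1 tofrac_eq -subr_eq0.
by rewrite -lead_coef_eq0 lead_coefXnsubC ?oner_eq0.
Qed.

Variable e : nat.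
Hypothesis e_gt0 : (0 < e)%N.

Let x_neq0 : qvar ^+ e != 0.
Proof. by rewrite expf_neq0 ?qvar_neq0. Qed.

Let xX_neq1 k : (0 < k)%N -> (qvar ^+ e) ^+ k != 1.
Proof. by move=> k0; rewrite -exprM qvarX_neq1 // muln_gt0 e_gt0. Qed.

Lemma qint1 : qint 1 (qvar ^+ e) = 1.
Proof. exact: qnum1. Qed.

Lemma qintN n : qint (- n) (qvar ^+ e) = - qint n (qvar ^+ e).
Proof. exact: qnumN. Qed.

Lemma qint_neq0 n : n != 0 -> qint n (qvar ^+ e) != 0.
Proof. exact: qnum_neq0. Qed.

Lemma qint_rec (m n : int) :
  qint n (qvar ^+ e) * qint (m - n + 1) (qvar ^+ e) +
    qint (m - n *+ 2) (qvar ^+ e) =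
  qint (n + 1) (qvar ^+ e) * qint (m - n) (qvar ^+ e).
Proof. exact: qnum_rec. Qed.

(** The power of q_s stays outside [y], so that it can later cancel the pole of [2]. *)
Lemma qint_ratio (a b : nat) : (a <= b)%N -> (0 < b)%N ->
  exists2 y, regular_at0 y &
    qint a (qvar ^+ e) / qint b (qvar ^+ e) = (qvar ^+ e) ^+ (b - a) * y.
Proof.
move=> ab b0.
(* For n > 0 this polynomial has constant term 1, so it is an admissible denominator. *)
pose g (n : nat) : {poly rat} := \sum_(j < n) 'X^(e * 2 * j).
have tg n : \sum_(j < n) ((qvar ^+ e) ^+ 2) ^+ j = tofrac (g n).
  rewrite /g rmorph_sum; apply: eq_bigr => j _.
  by rewrite -!exprM /qvar -tofracXn mulnA.
exists (tofrac (g a) / tofrac (g b)); last first.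
  by rewrite -!tg; apply: (qnum_ratio x_neq0 xX_neq1).
apply: regular_frac; rewrite /g -(prednK b0) horner_sum big_ord_recl.
rewrite muln0 expr0 hornerC big1 ?addr0 ?oner_eq0 // => j _.
by rewrite hornerXn expr0n !muln_eq0; case: e e_gt0.
Qed.

Lemma qint2 :
  exists2 y, regular_at0 y & qint 2 (qvar ^+ e) = (qvar ^+ e)^-1 * y.
Proof.
exists ((qvar ^+ e) ^+ 2 + 1); last exact: qnum2.
by rewrite -exprM; apply: regularD; [apply: regularX|apply: regular1].
Qed.

Lemma qint_ratio1 (n : nat) :
  vanishes_at0 (qint n (qvar ^+ e) / qint n.+1 (qvar ^+ e)).
Proof.
have [y ry ->] := qint_ratio (leqnSn n) isT; exists (qvar ^+ e.-1 * y).
  by apply: regularM => //; apply: regularX.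
by rewrite subSnn expr1 mulrA -exprS prednK.
Qed.

(** The simple zero in q_s of [n]/[n+1] exactly cancels the simple pole of [2]. *)
Lemma qint2_ratio1 (n : nat) :
  regular_at0 (qint 2 (qvar ^+ e) * (qint n (qvar ^+ e) / qint n.+1 (qvar ^+ e))).
Proof.
have [y ry ->] := qint_ratio (leqnSn n) isT; have [z rz ->] := qint2.
by rewrite subSnn expr1 mulrACA mulVf // mul1r; apply: regularM.
Qed.

Lemma qint_ratio1_eq (n : nat) : exists2 y, regular_at0 y &
  qint n (qvar ^+ e) = qvar * y * qint n.+1 (qvar ^+ e).
Proof.
have [y ry ey] := qint_ratio1 n; exists y => //.
have nz : qint n.+1 (qvar ^+ e) != 0 by apply: qint_neq0.
by rewrite -ey (divfK nz).
Qed.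

(** Write [n]/[n+2] as [n]/[n+1] times [n+1]/[n+2]: the second factor absorbs the pole of [2], the
    first still vanishes. *)
Lemma qint2_ratio2 (n : nat) :
  vanishes_at0 (qint 2 (qvar ^+ e) * (qint n (qvar ^+ e) / qint n.+2 (qvar ^+ e))).
Proof.
have [y ry ->] := qint_ratio1_eq n; have := qint2_ratio1 n.+1.
move: (qint 2 _) (qint n.+1 _) (qint n.+2 _)^-1 => a N z raNz.
exists (a * (N * z) * y); first exact: regularM.
by rewrite mulr_regroup.
Qed.

Lemma qint_ratio2 (n : nat) :
  vanishes_at0 (qint n (qvar ^+ e) / qint n.+2 (qvar ^+ e)).
Proof.
have [y ry ->] := qint_ratio1_eq n; have [z rz] := qint_ratio1 n.+1.
move: (qint n.+1 _) (qint n.+2 _)^-1 => N i hz; exists (y * (qvar * z)).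
  by do 2!apply: regularM => //; apply: regular_qvar.
by rewrite -hz -!mulrA.
Qed.

End RegularAtZero.

(** * Rooted forests *)

Section RootedForest.

Variables (Delta : finType) (A : Delta -> Delta -> int) (I : {set Delta}).
Hypothesis A_sym0 : forall s t, A s t = 0 -> A t s = 0.
Hypothesis acyclic : no_cycle A I.

Lemma adj_sym : symmetric (adj A I).
Proof.
move=> s t; rewrite /adj andbCA eq_sym; congr [&& _, _, _ & ~~ _].
by apply/eqP/eqP => /A_sym0.
Qed.

Definition adj_avoiding (x : Delta) : rel Delta :=
  fun a b => [&& adj A I a b, a != x & b != x].

Lemma adj_avoiding_path x z p :
  path (adj A I) z p -> x \notin z :: p -> path (adj_avoiding x) z p.
Proof.
elim: p z => //= y p IHp z /andP[zy yp]; rewrite in_cons negb_or => /andP[xz xp].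
rewrite IHp // andbT /adj_avoiding zy (eq_sym z) xz /=.
by move: xp; rewrite in_cons negb_or eq_sym => /andP[].
Qed.

(** A simple path from y to another neighbour y' of x that avoids x would close up through x to a
    cycle of length at least 3. *)
Lemma no_detour x y y' : adj A I x y -> adj A I x y' ->
  connect (adj_avoiding x) y y' -> y = y'.
Proof.
move=> xy xy' /connectP[p yp ey']; move: ey'; case/shortenP: yp => {}p yp uyp _ ey'.
case: p yp uyp ey' => [//|z p] yp uyp ey'.
have yx : y != x by move: xy; rewrite /adj eq_sym => /and4P[].
have xp : x \notin y :: z :: p.
  rewrite in_cons eq_sym (negbTE yx) /=.
  elim: (z :: p) y yp {uyp ey' xy yx} => //= b q IHq a /andP[/and3P[_ _ bx] bq].
  by rewrite in_cons eq_sym (negbTE bx) (IHq b).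
case: (acyclic (c := [:: x, y, z & p])) => //; apply/andP; split.
  rewrite -[cycle _ _]/(path (adj A I) x (rcons [:: y, z & p] x)) rcons_path.
  rewrite -[last _ _]/(last y (z :: p)) -ey' (adj_sym y') xy' andbT.
  by rewrite -[path _ _ _]/(_ && _) xy; apply: sub_path yp => a b /and3P[].
by rewrite cons_uniq xp.
Qed.

Variable Rt : {set Delta}.
Hypothesis RtP : root_choice A I Rt.

(** Take a simple path from x to its root. If y is not on it, putting y in front gives a simple path
    from y. If y is on it, y must be its first step, since otherwise the path joins two neighbours
    of x without meeting x. *)
Lemma towards_root_total x y : adj A I x y ->
  towards_root A I Rt x y \/ towards_root A I Rt y x.
Proof.
move=> xy; have xI : x \in I by case/and4P: xy.
have [_ /(_ x xI)] := RtP; move/eqP/cards1P => [r er].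
have : r \in [set r in Rt | connect (adj A I) x r] by rewrite er set11.
rewrite inE => /andP[rR /connectP[p xp er']].
move: er' rR; case/shortenP: xp => {}p xp uxp _ -> {er r} rR.
have yx : y != x by move: xy; rewrite /adj eq_sym => /and4P[].
have [yp|yp] := boolP (y \in p); last first.
  right; exists p; split=> //; first by rewrite /= adj_sym xy.
  by rewrite cons_uniq in_cons (negbTE yx) (negbTE yp) uxp.
left; case: p yp xp uxp rR => [//|z p]; rewrite in_cons.
have [<- _|yz] /= := eqVneq y z; first by move=> xp uxp rR; exists p.
move=> yp /andP[xz zp] /andP[xzp _] _; case/eqP: yz; apply/esym/(no_detour xz xy).
apply: (path_connect (adj_avoiding_path zp xzp)).
by rewrite inE yp orbT.
Qed.

(** Both simple paths end at the unique root of the component, so they connect y to y' while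
    avoiding x. *)
Lemma towards_root_inj x y y' :
  towards_root A I Rt x y -> towards_root A I Rt x y' -> y = y'.
Proof.
move=> [p [xp uxp pR]] [p' [xp' uxp' pR']].
have xI : x \in I by move: xp => /= /andP[/and4P[]].
have [_ /(_ x xI)] := RtP; move/eqP/cards1P => [r er].
have last_r q z : path (adj A I) x (z :: q) -> last z q \in Rt -> last z q = r.
  move=> xq zR; apply/set1P; rewrite -er inE zR /=.
  apply: (path_connect xq); exact: (mem_last x (z :: q)).
have conn q z : path (adj A I) x (z :: q) -> uniq (x :: z :: q) ->
    last z q \in Rt -> connect (adj_avoiding x) z r.
  move=> xq uq zR; rewrite -(last_r _ _ xq zR).
  move: xq uq => /= /andP[_ zq] /andP[xzq _].
  exact: (path_connect (adj_avoiding_path zq xzq) (mem_last _ _)).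
have xy : adj A I x y by case/andP: xp.
have xy' : adj A I x y' by case/andP: xp'.
apply: (no_detour xy xy'); apply: (connect_trans (conn _ _ xp uxp pR)).
have sym : connect_sym (adj_avoiding x).
  by apply: sym_connect_sym => a b; rewrite /adj_avoiding adj_sym (andbC (a != x)).
by rewrite sym; apply: conn xp' uxp' pR'.
Qed.

End RootedForest.

(** * Rank one: strings of weight vectors *)

Section WeightModule.

Variables (R : realType) (Delta : finType) (A : Delta -> Delta -> int).
Variables (d : Delta -> nat) (h : realization R A) (V : Uq_module d h).
Hypothesis d_gt0 : forall s, (0 < d s)%N.
Hypothesis A_diag : forall s, A s s = 2.

Local Notation E := (Eop V).
Local Notation F := (Fop V).
Local Notation "[ 'q' n ]_ s" := (qint n (qs d s)) (at level 0, format "[ 'q'  n ]_ s").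
Local Notation Fd := (divpow d (fun t => Fop V t)).

Implicit Types (s t : Delta) (mu nu : weight h) (u v : V) (k : int).

(** A relation, because weights take complex values on coroots and are known to be integral only
    where a non-zero weight vector exists. *)
Definition pairing mu s k : Prop := mu (simple_coroot h s) = k%:~R.

Lemma pairing_inj mu s k k' : pairing mu s k -> pairing mu s k' -> k = k'.
Proof. by rewrite /pairing => -> /intr_inj. Qed.

Lemma pairingD mu s t n k : pairing mu s k ->
  pairing (mu + simple_root h t *+ n) s (k + A s t *+ n).
Proof.
rewrite /pairing add_lfunE => ->; rewrite intrD; congr (_ + _).
by elim: n => [|n IHn]; rewrite ?mulr0n ?zero_lfunE // !mulrSr add_lfunE IHn
  simple_root_coroot intrD.
Qed.

Lemma pairingB mu s t k : pairing mu s k ->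
  pairing (mu - simple_root h t) s (k - A s t).
Proof.
rewrite /pairing add_lfunE opp_lfunE simple_root_coroot => ->.
by rewrite intrD mulrNz.
Qed.

Lemma has_weight0 mu : has_weight mu (0 : V).
Proof. exact: linear0. Qed.

Lemma has_weightD mu u v : has_weight mu u -> has_weight mu v -> has_weight mu (u + v).
Proof. by rewrite /has_weight linearD => -> ->. Qed.

Lemma has_weightZ mu c u : has_weight mu u -> has_weight mu (c *: u).
Proof. by rewrite /has_weight linearZ /= => ->. Qed.

Lemma has_weightN mu u : has_weight mu u -> has_weight mu (- u).
Proof. by rewrite /has_weight linearN => ->. Qed.

Lemma has_weightB mu u v : has_weight mu u -> has_weight mu v -> has_weight mu (u - v).
Proof. by move=> hu hv; apply/has_weightD/has_weightN. Qed.

Lemma has_weight_sum mu (J : Type) (r : seq J) (P : pred J) (f : J -> V) :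
  (forall j, has_weight mu (f j)) -> has_weight mu (\sum_(j <- r | P j) f j).
Proof.
move=> hf; elim/big_rec: _ => [|j v _ hv]; first exact: has_weight0.
exact: has_weightD.
Qed.

Lemma has_weight_inj mu nu v : v != 0 -> has_weight mu v -> has_weight nu v -> mu = nu.
Proof.
move=> v0 hm hn; have := wprojE mu nu v; rewrite [wproj V nu v]hn [wproj V mu v]hm.
by case: eqP => // _ v00; rewrite v00 eqxx in v0.
Qed.

Lemma has_weight_proj mu nu v : has_weight mu v ->
  wproj V nu v = if nu == mu then v else 0.
Proof. by move=> hv; rewrite -{1}[v]hv wprojE hv. Qed.

Lemma has_weightE s mu v : has_weight mu v -> has_weight (mu + simple_root h s) (E s v).
Proof. by rewrite /has_weight -Eop_weight => ->. Qed.

Lemma has_weightF s mu v : has_weight mu v -> has_weight (mu - simple_root h s) (F s v).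
Proof. by rewrite /has_weight -Fop_weight => ->. Qed.

Lemma has_weight_iterE s n mu v : has_weight mu v ->
  has_weight (mu + simple_root h s *+ n) (iter n (E s) v).
Proof.
move=> hv; elim: n => [|n IHn]; first by rewrite mulr0n addr0.
by rewrite mulrSr addrA /=; apply: has_weightE.
Qed.

Lemma has_weight_iterF s n mu v : has_weight mu v ->
  has_weight (mu - simple_root h s *+ n) (iter n (F s) v).
Proof.
move=> hv; elim: n => [|n IHn]; first by rewrite mulr0n subr0.
by rewrite mulrSr opprD addrA /=; apply: has_weightF.
Qed.

Lemma has_weight_divpow s n mu v : has_weight mu v ->
  has_weight (mu - simple_root h s *+ n) (Fd s n v).
Proof. by move=> hv; apply/has_weightZ/has_weight_iterF. Qed.

Lemma pairing_exists mu v s : has_weight mu v -> v != 0 -> exists k, pairing mu s k.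
Proof.
move=> hv v0; apply: (@wproj_integral _ _ _ _ _ V mu v).
by rewrite [wproj V mu v]hv.
Qed.

Lemma Kop_eigen s mu k v : pairing mu s k -> has_weight mu v ->
  Kop V s v = qs d s ^ k *: v.
Proof. by move=> hk hv; rewrite -{1}hv (Kop_weight _ hk) hv. Qed.

Lemma qs_neq0 s : qs d s != 0.
Proof. by rewrite expf_neq0 ?qvar_neq0. Qed.

Lemma Kinv_eigen s mu k v : pairing mu s k -> has_weight mu v ->
  Kinv V s v = qs d s ^ (- k) *: v.
Proof.
move=> hk hv; apply: (can_inj (KopK s)); rewrite KinvK linearZ /=.
by rewrite (Kop_eigen hk hv) scalerA -expfzDr ?qs_neq0 // addNr expr0z scale1r.
Qed.

Lemma E_F s mu k v : pairing mu s k -> has_weight mu v ->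
  E s (F s v) = F s (E s v) + [q k]_s *: v.
Proof.
move=> hk hv; have := EF_comm s s v; rewrite eqxx (Kop_eigen hk hv) (Kinv_eigen hk hv).
rewrite -scalerBl scalerA mulrC => <-.
by rewrite addrC subrK.
Qed.

Lemma E_F_comm s t v : s != t -> E s (F t v) = F t (E s v).
Proof. by move=> st; apply/eqP; rewrite -subr_eq0 EF_comm (negbTE st). Qed.

Lemma iterE0 s n : iter n (E s) 0 = 0.
Proof. by elim: n => //= n ->; rewrite linear0. Qed.

Lemma iterF0 s n : iter n (F s) 0 = 0.
Proof. by elim: n => //= n ->; rewrite linear0. Qed.

Lemma E_divpow_comm s t n v : s != t -> E s (Fd t n v) = Fd t n (E s v).
Proof.
move=> st; rewrite /divpow linearZ /=; congr (_ *: _).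
by elim: n => //= n IHn; rewrite E_F_comm // IHn.
Qed.

Lemma iterE_lin s n c u v : iter n (E s) (c *: u + v) = c *: iter n (E s) u + iter n (E s) v.
Proof. by elim: n => //= n ->; rewrite linearP. Qed.

Lemma iterE_sum s n (J : Type) (r : seq J) (P : pred J) (f : J -> V) :
  iter n (E s) (\sum_(j <- r | P j) f j) = \sum_(j <- r | P j) iter n (E s) (f j).
Proof. by elim: n => //= n ->; rewrite linear_sum. Qed.

Lemma iterF_lin s n c u v : iter n (F s) (c *: u + v) = c *: iter n (F s) u + iter n (F s) v.
Proof. by elim: n => //= n ->; rewrite linearP. Qed.

Lemma divpow_lin s n c u v : Fd s n (c *: u + v) = c *: Fd s n u + Fd s n v.
Proof. by rewrite /divpow iterF_lin scalerDr !scalerA mulrC. Qed.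

Lemma divpow_0 s n : Fd s n 0 = 0.
Proof. by rewrite /divpow iterF0 scaler0. Qed.

Lemma iterE_Z s n c u : iter n (E s) (c *: u) = c *: iter n (E s) u.
Proof. by rewrite -[c *: u]addr0 iterE_lin iterE0 addr0. Qed.

Lemma divpow_Z s n c u : Fd s n (c *: u) = c *: Fd s n u.
Proof. by rewrite -[c *: u]addr0 divpow_lin divpow_0 addr0. Qed.

Lemma qs_int_neq0 s k : k != 0 -> [q k]_s != 0.
Proof. exact: qint_neq0. Qed.

Lemma qfactS s n : qfact n.+1 (qs d s) = qfact n (qs d s) * [q n.+1]_s.
Proof. by rewrite /qfact big_nat_recr. Qed.

Lemma divpow0 s v : Fd s 0 v = v.
Proof. by rewrite /divpow /qfact big_geq // invr1 scale1r. Qed.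

Lemma divpow1 s v : Fd s 1 v = F s v.
Proof. by rewrite /divpow /qfact big_nat1 qint1 // invr1 scale1r. Qed.

Lemma F_divpow s n v : F s (Fd s n v) = [q n.+1]_s *: Fd s n.+1 v.
Proof.
rewrite /divpow linearZ /= scalerA; congr (_ *: _).
by rewrite qfactS invfM mulrCA mulfV ?mulr1 ?qs_int_neq0.
Qed.

Lemma pairing_sub mu s t n k : pairing mu s k ->
  pairing (mu - simple_root h t *+ n) s (k - A s t *+ n).
Proof.
move=> hk; elim: n => [|n IHn]; first by rewrite !mulr0n !subr0.
by rewrite !mulrSr !opprD !addrA; apply: pairingB.
Qed.

Lemma E_iterF s n mu k v : pairing mu s k -> has_weight mu v -> E s v = 0 ->
  E s (iter n.+1 (F s) v) = ([q n.+1]_s * [q (k - n%:Z)]_s) *: iter n (F s) v.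
Proof.
move=> hk hv v0; elim: n => [|n IHn].
  by rewrite /= (E_F hk hv) v0 linear0 add0r subr0 qint1 // mul1r.
rewrite iterS (E_F (pairing_sub s n.+1 hk) (has_weight_iterF _ n.+1 hv)) IHn.
rewrite linearZ /= -scalerDl; congr (_ *: _).
have := qint_rec (d_gt0 s) k n.+1; rewrite -/(qs d s) A_diag.
have -> : k - n.+1%:Z + 1 = k - n%:Z by lia.
have -> : 2 *+ n.+1 = n.+1%:Z *+ 2 by lia.
by have -> : n.+1%:Z + 1 = n.+2 by lia.
Qed.

Lemma E_divpow s n mu k v : pairing mu s k -> has_weight mu v -> E s v = 0 ->
  E s (Fd s n.+1 v) = [q (k - n%:Z)]_s *: Fd s n v.
Proof.
move=> hk hv v0; rewrite /divpow linearZ /= (E_iterF n hk hv v0) !scalerA.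
congr (_ *: _); rewrite qfactS invfM -mulrA.
by rewrite (mulrA _^-1 [q n.+1]_s) mulVf ?mul1r ?qs_int_neq0 // mulrC.
Qed.

(** The mirror image of [E_iterF]: E_s and F_s are exchanged and the pairing changes sign. *)
Lemma F_iterE s n mu k v : pairing mu s k -> has_weight mu v -> F s v = 0 ->
  F s (iter n.+1 (E s) v) = ([q n.+1]_s * [q (- k - n%:Z)]_s) *: iter n (E s) v.
Proof.
move=> hk hv v0; elim: n => [|n IHn].
  have := E_F hk hv; rewrite v0 linear0 /= => /esym/eqP.
  by rewrite addr_eq0 => /eqP ->; rewrite subr0 qint1 // mul1r qintN // scaleNr.
(* Adding the commutator term turns the left side into E_s F_s E_s^(n+1) v, to which the induction
   hypothesis applies. *)
apply: (addIr ([q (k + A s s *+ n.+1)]_s *: iter n.+1 (E s) v)).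
rewrite [iter n.+2 _ _]iterS -(E_F (pairingD s n.+1 hk) (has_weight_iterE s n.+1 hv)).
rewrite IHn linearZ -iterS /= -scalerDl; congr (_ *: _).
have := qint_rec (d_gt0 s) (- k) n.+1; rewrite -/(qs d s) A_diag.
have -> : - k - n.+1%:Z + 1 = - k - n%:Z by lia.
have -> : n.+1%:Z + 1 = n.+2 by lia.
move=> <-; rewrite -addrA -[LHS]addr0; congr (_ + _); apply/esym/eqP.
by rewrite addrC addr_eq0 -qintN //; apply/eqP; congr [q _]_s; lia.
Qed.

(** Moving E_s past F_s costs only a multiple of v, so F_s lengthens the E_s-string by at most
    one. *)
Lemma iterE_F_eq0 s n mu v : has_weight mu v ->
  iter n (E s) v = 0 -> iter n.+1 (E s) (F s v) = 0.
Proof.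
elim: n mu v => [|n IHn] mu v hv; first by move=> /= ->; rewrite !linear0.
have [-> _|v0] := eqVneq v 0; first by rewrite linear0 iterE0.
have [k hk] := pairing_exists s hv v0.
rewrite iterSr => e0; rewrite iterSr (E_F hk hv) addrC iterE_lin.
by rewrite (IHn _ _ (has_weightE s hv)) // addr0 [iter n.+1 _ _]iterSr e0 scaler0.
Qed.

(* Descend with F_s to the bottom of the string; there E_s^n is injective for n
   up to minus the pairing. *)
Lemma low_weight_eq0 s n mu k v : integrable V -> pairing mu s k ->
  has_weight mu v -> iter n (E s) v = 0 -> k + n%:Z <= 0 -> v = 0.
Proof.
move=> Vint; have [r [_ hr]] := Vint s v; elim: r n mu k v hr => [|r IHr] //.
move=> n mu k v; rewrite iterSr => hr hk hv e0 kn.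
have Fv0 : F s v = 0.
  apply: (IHr n.+1 _ (k - 2) _ hr _ (has_weightF s hv) (iterE_F_eq0 hv e0)).
    by rewrite -(A_diag s); apply: pairingB.
  by lia.
suff H j : (j <= n)%N -> iter j (E s) v = 0 -> v = 0 by apply: H e0.
elim: j => // j IHj jn e0'; apply: IHj; first lia.
have := F_iterE j hk hv Fv0; rewrite e0' linear0 => /esym/eqP.
by rewrite scaler_eq0 mulf_eq0 !(negbTE (qs_int_neq0 _ _)) //=; [move/eqP|lia].
Qed.

(** The scalar is the product of the [k - n + i] for i = 1, ..., j, whose arguments are positive
    once n <= k. *)
Lemma iterE_divpow s n mu k v j : pairing mu s k -> has_weight mu v -> E s v = 0 ->
  (j <= n)%N -> exists2 c, iter j (E s) (Fd s n v) = c *: Fd s (n - j) v &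
    (n%:Z <= k -> c != 0).
Proof.
move=> hk hv v0; elim: j => [|j IHj] jn.
  by exists 1; rewrite ?subn0 ?scale1r ?oner_neq0.
have [c ec c0] := IHj (ltnW jn).
exists (c * [q (k - (n - j.+1)%N%:Z)]_s).
  by rewrite iterS ec linearZ /= -(subnSK jn) (E_divpow _ hk hv v0) scalerA.
by move=> nk; apply: mulf_neq0; [apply: c0|apply: qs_int_neq0; lia].
Qed.

Lemma iterE_divpow_eq0 s n mu k v j : pairing mu s k -> has_weight mu v -> E s v = 0 ->
  (n < j)%N -> iter j (E s) (Fd s n v) = 0.
Proof.
move=> hk hv v0; case: j => // j nj.
have [c ec _] := iterE_divpow hk hv v0 (leqnn n).
rewrite -(subnKC nj) addnC iterD /= ec subnn divpow0 linearZ /= v0 scaler0.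
by rewrite iterE0.
Qed.

(** * String decompositions and the operators defined through them *)

Hypothesis Vint : integrable V.

(** Induction on n, peeling off the top component: if E_s^(n+1) v = 0, then E_s^n v is killed by
    E_s, and subtracting F_s^(n) of a suitable multiple of it leaves a vector killed by E_s^n. *)
Lemma string_dec_exists s n mu v : has_weight mu v -> iter n (E s) v = 0 ->
  exists a_, string_dec s mu n a_ v.
Proof.
(* The components are also required to be 0 from n on, so that the range of summation can be
   extended. *)
move=> hv en; suff [a_ [hu _]] : exists a_, string_dec s mu n a_ v /\
    (forall i, (n <= i)%N -> a_ i = 0) by exists a_.
elim: n v hv en => [|n IHn] v hv en.
  exists (fun=> 0); split=> //; split=> [i|i|i|]; rewrite ?linear0 ?big_geq ?eqxx //.
  exact: has_weight0.
have [wn0|wn0] := eqVneq (iter n (E s) v) 0.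
  have [a_ [[h1 h2 h3 h4] h5]] := IHn v hv wn0; exists a_; split.
    by split=> //; rewrite big_nat_recr //= h5 // divpow_0 addr0 -h4.
  by move=> i ni; apply: h5; apply: ltnW.
have v0 : v != 0 by apply: contraNneq wn0 => ->; rewrite iterE0.
have [k hk] := pairing_exists s hv v0.
(* Integrability enters here: n is at most k + 2n, the pairing of the top component, which makes the
   scalar [c] below non-zero. *)
have kn : 0 <= k + n%:Z.
  rewrite leNgt; apply: contra v0 => kn; apply/eqP.
  by apply: (low_weight_eq0 Vint hk hv en); lia.
have hw := has_weight_iterE s n hv; have hkw := pairingD s n hk.
have ew : E s (iter n (E s) v) = 0 by rewrite -iterS.
have [c ec c0] := iterE_divpow hkw hw ew (leqnn n).
have {}c0 : c != 0 by apply: c0; rewrite A_diag; lia.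
rewrite subnn divpow0 in ec.
set u := c^-1 *: iter n (E s) v.
have hu : has_weight (mu + simple_root h s *+ n) u by apply: has_weightZ.
pose v' := - 1 *: Fd s n u + v.
have hF : has_weight mu (Fd s n u).
  by rewrite -[mu](addrK (simple_root h s *+ n)); apply: has_weight_divpow.
have hv' : has_weight mu v' by apply: has_weightD => //; apply: has_weightZ.
have ev' : iter n (E s) v' = 0.
  rewrite iterE_lin /u divpow_Z iterE_Z ec scaleN1r scalerA mulVf // scale1r.
  exact: addNr.
have [a_ [[h1 h2 h3 h4] h5]] := IHn v' hv' ev'.
exists (fun i => if i == n then u else a_ i); split; last first.
  by move=> i ni; rewrite gtn_eqF // h5 // ltnW.
split=> [i|i|i|].
- by case: (i =P n) => // _; rewrite linearZ /= ew scaler0.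
- by case: (i =P n) => [->|_]; [apply: hu|apply: h2].
- case: (i =P n) => [-> _|_]; last exact: h3.
  exists (absz (k + A s s *+ n)); first by rewrite A_diag; lia.
  by rewrite hkw [RHS]pmulrn; congr (1 *~ _); rewrite A_diag; lia.
- rewrite big_nat_recr //= eqxx -[v](addKr (- 1 *: Fd s n u)) -/v' h4 addrC scaleN1r opprK.
  by congr (_ + _); apply: eq_big_nat => i /andP[_ ni]; rewrite ltn_eqF.
Qed.

(** The vector does not determine the components of index N and above. Setting them to 0 lets
    decompositions of different lengths be added. *)
Definition trunc (N : nat) (a_ : nat -> V) (n : nat) : V := if (n < N)%N then a_ n else 0.

Lemma trunc_sum (g : nat -> V -> V) N N' a_ :
  (forall n, g n 0 = 0) -> (N <= N')%N ->
  \sum_(0 <= n < N') g n (trunc N a_ n) = \sum_(0 <= n < N) g n (a_ n).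
Proof.
move=> g0 NN'; rewrite (big_cat_nat (n := N)) //= [X in _ + X]big1_seq ?addr0.
  by apply: eq_big_nat => i /andP[_ iN]; rewrite /trunc iN.
by move=> i; rewrite andTb mem_index_iota => /andP[Ni _]; rewrite /trunc ltnNge Ni.
Qed.

Lemma string_dec_trunc s mu N N' a_ u : (N <= N')%N ->
  string_dec s mu N a_ u -> string_dec s mu N' (trunc N a_) u.
Proof.
move=> NN' [h1 h2 h3 h4]; split=> [n|n|n|].
- by rewrite /trunc; case: ifP; rewrite ?linear0.
- by rewrite /trunc; case: ifP => // _; apply: has_weight0.
- by rewrite /trunc; case: ifP => // _; [apply: h3|rewrite eqxx].
- by rewrite (trunc_sum (g := Fd s)) // => n; rewrite divpow_0.
Qed.

Lemma string_dec_weight s mu N a_ u : string_dec s mu N a_ u -> has_weight mu u.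
Proof.
move=> [_ h2 _ ->]; apply: has_weight_sum => n.
by rewrite -[mu](addrK (simple_root h s *+ n)); apply: has_weight_divpow.
Qed.

Lemma string_dec_lin s mu N a_ u a'_ u' c :
  string_dec s mu N a_ u -> string_dec s mu N a'_ u' ->
  string_dec s mu N (fun n => c *: a_ n + a'_ n) (c *: u + u').
Proof.
move=> [h1 h2 h3 h4] [h1' h2' h3' h4']; split=> [n|n|n|].
- by rewrite linearP /= h1 h1' scaler0 addr0.
- by apply: has_weightD => //; apply: has_weightZ.
- have [un0|un0 _] := eqVneq (a_ n) 0; last exact: h3.
  by rewrite un0 scaler0 add0r; apply: h3'.
- rewrite h4 h4' scaler_sumr -big_split; apply: eq_bigr => n _.
  by rewrite divpow_lin.
Qed.

(** Uniqueness of string decompositions: the power of E_s given by the top index kills all lower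
    terms and sends the top one to a non-zero multiple of its component. *)
Lemma string_dec0 s mu N a_ n : string_dec s mu N a_ (0 : V) -> (n < N)%N -> a_ n = 0.
Proof.
elim: N => // N IHN hN.
have uN : a_ N = 0.
  case: hN => [h1 h2 h3 h4]; apply/eqP/negPn/negP => uN0.
  have [m Nm hm] := h3 _ uN0.
  have := congr1 (iter N (E s)) h4; rewrite iterE0 iterE_sum big_nat_recr //=.
  have pk i : a_ i != 0 -> exists k, pairing (mu + simple_root h s *+ i) s k.
    by move=> /(pairing_exists s (h2 i)).
  rewrite big_nat big1 => [|i /andP[_ iN]]; last first.
    have [->|/pk[k hk]] := eqVneq (a_ i) 0; first by rewrite divpow_0 iterE0.
    exact: iterE_divpow_eq0 hk (h2 i) (h1 i) iN.
  have hm' : pairing (mu + simple_root h s *+ N) s m%:Z by rewrite /pairing hm pmulrn.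
  have [c -> c0] := iterE_divpow hm' (h2 N) (h1 N) (leqnn N).
  rewrite subnn divpow0 add0r => /esym/eqP; rewrite scaler_eq0 (negbTE uN0) orbF.
  by apply/negP/c0; lia.
rewrite ltnS leq_eqVlt => /predU1P[->//|nN]; apply: IHN nN.
case: hN => [h1 h2 h3]; rewrite big_nat_recr //= uN divpow_0 addr0 => h4.
by split.
Qed.

(* Both Kashiwara operators replace F_s^(n) by another linear operator g n in
   the string decomposition. *)
Definition string_op (g : nat -> V -> V) s u v : Prop :=
  exists mu N a_, string_dec s mu N a_ u /\ v = \sum_(0 <= n < N) g n (a_ n).

Definition Fshift s n := Fd s n.+1.
Definition Eshift s n v := if n is m.+1 then Fd s m v else 0.

Lemma kashiwaraE_op s u v : kashiwaraE s u v <-> string_op (Eshift s) s u v.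
Proof.
have shift N (a_ : nat -> V) : \sum_(1 <= n < N) Fd s n.-1 (a_ n) =
    \sum_(0 <= n < N) Eshift s n (a_ n).
  case: N => [|N]; first by rewrite !big_geq.
  by rewrite [RHS]big_ltn //= add0r; apply: eq_big_nat => -[].
by split=> -[mu [N [a_ [ha ->]]]]; exists mu, N, a_; rewrite shift.
Qed.

Definition termwise_linear (g : nat -> V -> V) : Prop :=
  forall n (a : Qq) u v, g n (a *: u + v) = a *: g n u + g n v.

Section StringOperator.
Variables (g : nat -> V -> V) (s : Delta).
Hypothesis g_lin : termwise_linear g.

Lemma string_op_g0 n : g n 0 = 0.
Proof. by have := g_lin n (-1) 0 0; rewrite scaler0 addr0 => ->; rewrite scaleN1r addNr. Qed.

Lemma string_op_lin0 mu N a_ : string_dec s mu N a_ (0 : V) -> \sum_(0 <= n < N) g n (a_ n) = 0.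
Proof.
move=> hu; rewrite big_nat big1 // => n /andP[_ nN].
by rewrite (string_dec0 hu nN) string_op_g0.
Qed.

(** The weight hidden in [string_op] is forced when u is non-zero. For u = 0 the empty decomposition
    serves at any weight. *)
Lemma string_op_at mu u v : has_weight mu u -> string_op g s u v ->
  exists N a_, string_dec s mu N a_ u /\ v = \sum_(0 <= n < N) g n (a_ n).
Proof.
move=> hu [nu [N [a_ [hd hv]]]]; have [u0|u0] := eqVneq u 0.
  exists 0, (fun=> 0); rewrite big_geq //; split; last first.
    by rewrite hv; apply: (string_op_lin0 (mu := nu)); rewrite -u0.
  rewrite u0; split=> [i|i|i|]; rewrite ?linear0 ?eqxx ?big_geq //.
  exact: has_weight0.
by exists N, a_; rewrite (has_weight_inj u0 hu (string_dec_weight hd)).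
Qed.

Lemma string_op_lin mu c u v u' v' : has_weight mu u -> has_weight mu u' ->
  string_op g s u v -> string_op g s u' v' ->
  string_op g s (c *: u + u') (c *: v + v').
Proof.
move=> hu hu' /(string_op_at hu)[N [a_ [hd ->]]] /(string_op_at hu')[N' [a'_ [hd' ->]]].
exists mu, (maxn N N'), (fun n => c *: trunc N a_ n + trunc N' a'_ n); split.
  by apply: string_dec_lin; apply: string_dec_trunc; rewrite ?leq_maxl ?leq_maxr.
rewrite -(@trunc_sum g _ _ a_ string_op_g0 (leq_maxl N N')).
rewrite -(@trunc_sum g _ _ a'_ string_op_g0 (leq_maxr N N')).
by rewrite scaler_sumr -big_split; apply: eq_bigr => n _; rewrite g_lin.
Qed.

Lemma string_op_fun u v v' : string_op g s u v -> string_op g s u v' -> v = v'.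
Proof.
move=> h1 h2; have hu : exists mu, has_weight mu u.
  by have [mu [N [a_ [hd _]]]] := h1; exists mu; apply: string_dec_weight hd.
have [mu {}hu] := hu; have := string_op_lin (-1) hu hu h1 h2.
rewrite !scaleN1r addNr => -[nu [N [a_ [hd hv]]]].
by apply/esym/eqP; rewrite -subr_eq0 addrC hv (string_op_lin0 hd).
Qed.

Lemma string_op_exists n mu u : has_weight mu u -> iter n (E s) u = 0 ->
  exists v, string_op g s u v.
Proof.
move=> hu /(string_dec_exists hu)[a_ hd].
by exists (\sum_(0 <= i < n) g i (a_ i)), mu, n, a_.
Qed.

End StringOperator.

Lemma Fshift_lin s : termwise_linear (Fshift s).
Proof. by move=> n a u v; apply: divpow_lin. Qed.

Lemma Eshift_lin s : termwise_linear (Eshift s).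
Proof. by move=> [|n] a u v /=; rewrite ?scaler0 ?addr0 ?divpow_lin. Qed.

(** * Weights of the highest weight module *)

Hypothesis A_offdiag : forall s t, s != t -> A s t <= 0.
Variable rho : weight h.
Hypothesis rhoP : forall s, rho (simple_coroot h s) = 1.
Hypothesis V_irr : irreducible_module V.
Hypothesis V_rho : highest_weight V rho.

Implicit Types c : Delta -> nat.

Lemma simple_root_indep (k : Delta -> int) :
  \sum_s simple_root h s *~ k s = 0 -> forall s, k s = 0.
Proof.
move=> k0 s; have sz : size (map (simple_root h) (enum Delta)) == #|Delta|.
  by rewrite size_map -cardE.
have := simple_root_free h; rewrite -[map _ _]/(tval (Tuple sz)) => /freeP fr.
have := fr (fun i => (k (enum_val i))%:~R).
have -> : \sum_(i < #|Delta|) (k (enum_val i))%:~R *: (Tuple sz)`_i =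
          \sum_s simple_root h s *~ k s.
  rewrite (reindex _ (onW_bij _ (enum_val_bij Delta))) /=.
  apply: eq_bigr => i _; rewrite scaler_int; congr (_ *~ _).
  by rewrite (nth_map (enum_val i)) -?cardE // -enum_val_nth.
by move=> /(_ k0 (enum_rank s)) /eqP; rewrite enum_rankK intr_eq0 => /eqP.
Qed.

(** Every weight of V has this form ([weight_depth]), and c_s then bounds how often E_s can act
    without giving 0. *)
Definition depth_weight c : weight h := rho - \sum_s simple_root h s *+ c s.
Definition depth_pairing c s : int := 1 - \sum_t A s t *+ c t.

Lemma eq_depth_weight c c' : c =1 c' -> depth_weight c = depth_weight c'.
Proof. by move=> cc'; congr (_ - _); apply: eq_bigr => s _; rewrite cc'. Qed.

Lemma depth_weightP c s : pairing (depth_weight c) s (depth_pairing c s).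
Proof.
rewrite /pairing /depth_weight add_lfunE opp_lfunE rhoP /depth_pairing intrB; congr (_ - _).
rewrite sum_lfunE rmorph_sum; apply: eq_bigr => t _ /=.
elim: (c t) => [|n IHn]; rewrite ?mulr0n ?zero_lfunE // !mulrSr add_lfunE IHn.
by rewrite simple_root_coroot intrD.
Qed.

Lemma depth_weight_eq c c' s n :
  depth_weight c + simple_root h s *+ n = depth_weight c' ->
  forall t, (c t = c' t + n * (t == s))%N.
Proof.
move=> e t; pose k t : int := (c t)%:Z - (c' t + n * (t == s))%:Z.
suff /(_ t) : forall t, k t = 0 by rewrite /k; lia.
apply: simple_root_indep.
have -> : \sum_t simple_root h t *~ k t = \sum_t simple_root h t *+ c t -
     (\sum_t simple_root h t *+ c' t + simple_root h s *+ n).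
  have -> : simple_root h s *+ n = \sum_t simple_root h t *+ (n * (t == s)).
    rewrite (bigD1 s) //= eqxx muln1 big1 ?addr0 // => r /negbTE ->.
    by rewrite muln0.
  rewrite -big_split -sumrB; apply: eq_bigr => r _ /=.
  by rewrite /k mulrzBr -!pmulrn mulrnDr.
apply/eqP; rewrite subr_eq0; apply/eqP; move: e; rewrite /depth_weight.
move: (\sum_t _) (\sum_t _) => X Y /(canRL (addrK _)) e.
by apply: oppr_inj; apply: (addrI rho); rewrite e opprD addrA.
Qed.

Lemma sum_simple_root_incr t c :
  \sum_s simple_root h s *+ (c s + (t == s)) =
  \sum_s simple_root h s *+ c s + simple_root h t.
Proof.
under eq_bigr => s _ do rewrite mulrnDr.
rewrite big_split /=; congr (_ + _).
by rewrite (bigD1 t) //= eqxx mulr1n big1 ?addr0 // => s; rewrite eq_sym => /negbTE ->.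
Qed.

Definition F_word (w : seq Delta) v : V := foldr (fun s => F s) v w.

Lemma has_weight_F_word w mu v : has_weight mu v ->
  has_weight (mu - \sum_s simple_root h s *+ count_mem s w) (F_word w v).
Proof.
move=> hv; elim: w => [|t w IHw] /=; first by rewrite big1 ?subr0.
under eq_bigr => s _ do rewrite addnC.
rewrite sum_simple_root_incr.
by rewrite opprD addrA; apply: has_weightF.
Qed.

(** The span of all words in the F_s applied to a highest weight vector is a submodule, hence all of
    V by irreducibility. For stability under E_s, move it rightwards through the word. *)
Lemma F_word_span : exists2 u, has_weight rho u & forall v,
  exists l : seq (Qq * seq Delta), v = \sum_(p <- l) p.1 *: F_word p.2 u.
Proof.
have [u [u0 hu Eu]] := V_rho; exists u => //.
pose W v := exists l : seq (Qq * seq Delta), v = \sum_(p <- l) p.1 *: F_word p.2 u.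
have W0 : W 0 by exists [::]; rewrite big_nil.
have WP (a : Qq) v w : W v -> W w -> W (a *: v + w).
  move=> [l ->] [l' ->]; exists ([seq (a * p.1, p.2) | p <- l] ++ l').
  rewrite big_cat big_map scaler_sumr; congr (_ + _).
  by apply: eq_bigr => p _; rewrite scalerA.
have Ww w : W (F_word w u) by exists [:: (1, w)]; rewrite big_seq1 scale1r.
have Wlin (T : {linear V -> V}) : (forall w, W (T (F_word w u))) -> forall v, W v -> W (T v).
  move=> hT v [l ->]; rewrite linear_sum; elim/big_rec: _ => // p v' _ hv'.
  by rewrite linearZ /=; apply: WP.
have WF s v : W v -> W (F s v) by apply: Wlin => w; apply: (Ww (s :: w)).
have subW : is_submodule W.
  split=> // [mu v|s v]; apply: Wlin => w.
    by rewrite (has_weight_proj _ (has_weight_F_word w hu)); case: eqP.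
  elim: w => [|t w IHw] /=; first by rewrite Eu.
  have [<-|st] := eqVneq s t; last by rewrite E_F_comm //; apply: WF.
  have hw := has_weight_F_word w hu; have [->|w0] := eqVneq (F_word w u) 0.
    by rewrite !linear0.
  have [k hk] := pairing_exists s hw w0.
  by rewrite (E_F hk hw) addrC; apply/WP/WF.
have [Wz|//] := (V_irr.2 W subW).
by case/eqP: u0; apply: Wz; apply: (Ww [::]).
Qed.

(** If mu were the weight of no word in an expression for v, projecting to the weight mu would kill
    v. *)
Lemma weight_depth mu v : v != 0 -> has_weight mu v -> exists c, mu = depth_weight c.
Proof.
move=> v0 hv; have [u hu span] := F_word_span; have [l el] := span v.
have [/hasP[p _ /eqP ->]|/hasPn nh] := boolP (has (fun p : Qq * seq Delta =>
    mu == rho - \sum_s simple_root h s *+ count_mem s p.2) l).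
  by exists (fun s => count_mem s p.2).
case/eqP: v0; rewrite -hv el linear_sum big1_seq // => p /andP[_ /nh hp].
by rewrite linearZ /= (has_weight_proj _ (has_weight_F_word _ hu)) (negbTE hp) scaler0.
Qed.

Lemma has_weight_depth_le c s n v : v != 0 ->
  has_weight (depth_weight c + simple_root h s *+ n) v -> (n <= c s)%N.
Proof.
move=> v0 /(weight_depth v0)[c' /depth_weight_eq/(_ s)].
by rewrite eqxx muln1 => ->; apply: leq_addl.
Qed.

Lemma iterE_depth_eq0 c s n v : has_weight (depth_weight c) v -> (c s < n)%N ->
  iter n (E s) v = 0.
Proof.
move=> hv cn; apply/eqP; apply: contraTT cn => v0; rewrite -leqNgt.
exact: has_weight_depth_le v0 (has_weight_iterE s n hv).
Qed.

Definition incr c s : Delta -> nat := fun t => (c t + (s == t))%N.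

Lemma depth_weight_incr c s : depth_weight (incr c s) = depth_weight c - simple_root h s.
Proof. by rewrite /depth_weight sum_simple_root_incr opprD addrA.
Qed.

Lemma depth_pairing_incr c s t : depth_pairing (incr c s) t = depth_pairing c t - A t s.
Proof.
apply: pairing_inj (depth_weightP _ t) _; rewrite depth_weight_incr.
exact/pairingB/depth_weightP.
Qed.

(** Only off-diagonal entries contribute, with the favourable sign, on top of the 1 coming from
    rho. *)
Lemma depth_pairing_gt0 c s : c s = 0 -> 0 < depth_pairing c s.
Proof.
move=> cs; rewrite /depth_pairing subr_gt0 (@le_lt_trans _ _ 0) //.
apply: sumr_le0 => t _; have [<-|st] := eqVneq s t; first by rewrite cs mulr0n.
by rewrite pmulrn mulrz_le0_ge0 // A_offdiag.
Qed.

(** * Crystal bases *)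

Variable B : crystal_base V.
Local Notation L := (lattice B).
Local Notation qL := (in_qL (lattice B)).
Local Notation rep := (@Defs.rep _ _ _ _ _ _ B).
Local Notation represents := (Defs.represents (lattice B) rep).

(** The index sequences in [lin_comb] may differ and contain repetitions, so both sums are first
    rewritten over a common list without repetitions, the multiplicities going into the
    coefficients. *)
Lemma lattice_lin a u v : regular_at0 a -> L u -> L v -> L (a *: u + v).
Proof.
have [J [e [_ _ Le]]] := lattice_free B; move=> ra.
have collect (S js : seq J) (G : J -> V) : uniq S -> {subset js <= S} ->
    \sum_(j <- S) G j *+ count_mem j js = \sum_(j <- js) G j.
  move=> uS; elim: js => [|a0 js IHjs] sub; first by rewrite big_nil big1.
  rewrite big_cons -IHjs => [|j jjs]; last by apply: sub; rewrite in_cons jjs orbT.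
  under eq_bigr => j _ do rewrite /= mulrnDr.
  rewrite big_split /=; congr (_ + _).
  rewrite (bigD1_seq a0) ?sub ?mem_head //= eqxx mulr1n big1 ?addr0 // => j.
  by rewrite eq_sym => /negbTE ->.
move=> /Le[js [c [rc ->]]] /Le[js' [c' [rc' ->]]]; apply/Le.
exists (undup (js ++ js')), (fun j => a * (c j *+ count_mem j js) + c' j *+ count_mem j js').
split=> [j|].
  by apply: regularD; [apply: regularM => //|]; apply: regularMn.
rewrite -(collect (undup (js ++ js')) js) ?undup_uniq //; last first.
  by move=> j; rewrite mem_undup mem_cat => ->.
rewrite -(collect (undup (js ++ js')) js') ?undup_uniq //; last first.
  by move=> j; rewrite mem_undup mem_cat orbC => ->.
rewrite scaler_sumr -big_split; apply: eq_bigr => j _ /=.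
by rewrite scalerDl -scalerA !scalerMnl.
Qed.

Lemma lattice0 : L 0.
Proof.
have [J [e [_ _ Le]]] := lattice_free B; apply/Le.
by exists [::], (fun=> 0); rewrite big_nil; split=> // _; apply: regular0.
Qed.

Lemma latticeZ a u : regular_at0 a -> L u -> L (a *: u).
Proof. by move=> ra Lu; rewrite -[_ *: _]addr0; apply: lattice_lin => //; apply: lattice0. Qed.

Lemma latticeD u v : L u -> L v -> L (u + v).
Proof. by move=> Lu Lv; rewrite -[u]scale1r; apply: lattice_lin => //; apply: regular1. Qed.

Lemma latticeN u : L u -> L (- u).
Proof. by move=> Lu; rewrite -scaleN1r; apply: latticeZ => //; apply/regularN/regular1. Qed.

Lemma latticeB u v : L u -> L v -> L (u - v).
Proof. by move=> Lu Lv; apply: latticeD => //; apply: latticeN. Qed.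

Lemma qLD u v : qL u -> qL v -> qL (u + v).
Proof.
move=> [w Lw ->] [w' Lw' ->]; exists (w + w'); last by rewrite scalerDr.
exact: latticeD.
Qed.

Lemma qLN u : qL u -> qL (- u).
Proof. by move=> [w Lw ->]; exists (- w); rewrite ?scalerN //; apply: latticeN. Qed.

Lemma qLB u v : qL u -> qL v -> qL (u - v).
Proof. by move=> qu qv; apply: qLD => //; apply: qLN. Qed.

Lemma qL0 : qL 0.
Proof. by exists 0; rewrite ?scaler0 //; apply: lattice0. Qed.

Lemma qLZ a u : vanishes_at0 a -> L u -> qL (a *: u).
Proof. by move=> [b rb ->] Lu; exists (b *: u); rewrite ?scalerA //; apply: latticeZ. Qed.

Lemma rep_notin_qL b : ~ qL (rep b).
Proof.
move=> qb; have := @rep_indep _ _ _ _ _ _ B [:: b] (fun=> 1) isT.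
rewrite big_seq1 /qconst tofrac1 scale1r => /(_ qb b); rewrite mem_head => /(_ isT)/eqP.
by rewrite oner_eq0.
Qed.

Lemma represents_None v : represents None v <-> qL v.
Proof. by rewrite /Defs.represents /= subr0. Qed.

Lemma represents_rep b : represents (Some b) (rep b).
Proof. by rewrite /Defs.represents subrr; apply: qL0. Qed.

(** Two different classes of the same vector would give a non-trivial linear relation modulo qL
    between elements of B. *)
Lemma represents_fun x y v : represents x v -> represents y v -> x = y.
Proof.
rewrite /Defs.represents => hx hy; have : qL (oapp rep 0 y - oapp rep 0 x).
  have -> : oapp rep 0 y - oapp rep 0 x = (v - oapp rep 0 x) - (v - oapp rep 0 y).
    by rewrite opprB [RHS]addrC addrA subrK.
  exact: qLB.
case: x y {hx hy} => [b|] [b'|] //=.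
- have [->//|bb' qbb'] := eqVneq b b'.
  have := @rep_indep _ _ _ _ _ _ B [:: b; b'] (fun a => if a == b then - 1 else 1).
  have b'b : (b' == b) = false by rewrite eq_sym (negbTE bb').
  rewrite big_cons big_seq1 /= inE andbT eqxx (negbTE bb') b'b => /(_ isT).
  rewrite /qconst polyCN tofracN tofrac1 scale1r scaleN1r addrC => /(_ qbb' b').
  by rewrite !inE eqxx orbT b'b => /(_ isT)/eqP; rewrite oner_eq0.
- by rewrite sub0r => /qLN; rewrite opprK => /rep_notin_qL.
- by rewrite subr0 => /rep_notin_qL.
Qed.

Lemma qL_proj mu v : qL v -> qL (wproj V mu v).
Proof.
move=> [w Lw ->]; exists (wproj V mu w); last by rewrite linearZ.
exact: lattice_weight.
Qed.

(** Since qL is stable under weight projections, projecting v - [rep b] to another weight [wt b]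
    would put [rep b] into qL. *)
Lemma represents_wt b mu v : has_weight mu v -> represents (Some b) v -> wt b = mu.
Proof.
move=> hv hb; apply/eqP/negPn/negP => ne; have := qL_proj (wt b) hb.
rewrite linearB /= (has_weight_proj _ hv) (negbTE ne) (rep_weight b) sub0r => /qLN.
by rewrite opprK => /rep_notin_qL.
Qed.

Definition lattice_stable (g : nat -> V -> V) s :=
  forall u v, L u -> string_op g s u v -> L v.

(** Divide by q: the vector q^-1 u lies in L, and by linearity q^-1 v is its image. *)
Lemma qL_string_op g s mu u v :
  termwise_linear g -> lattice_stable g s ->
  has_weight mu u -> qL u -> string_op g s u v -> qL v.
Proof.
move=> g_lin stab hu [w Lw uw] huv; exists (qvar^-1 *: v); last first.
  by rewrite scalerA divff ?qvar_neq0 ?scale1r.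
have -> : qvar^-1 *: v = qvar^-1 *: v + 0 by rewrite addr0.
apply: (stab w) => //; have -> : w = qvar^-1 *: u + 0.
  by rewrite addr0 uw scalerA mulVf ?qvar_neq0 ?scale1r.
apply: (string_op_lin g_lin _ hu (has_weight0 mu)) => //.
exists mu, 0, (fun=> 0); rewrite !big_geq //; split=> //.
by split=> [n|n|n|]; rewrite ?linear0 ?eqxx ?big_geq //; apply: has_weight0.
Qed.

(** Allows a crystal operator to be computed on any homogeneous representative: u and [rep b] differ
    by a vector of qL, whose image stays in qL. *)
Lemma represents_string_op g s til x mu u v :
  termwise_linear g -> lattice_stable g s ->
  (forall b, exists2 w, string_op g s (rep b) w & represents (til b) w) ->
  has_weight mu u -> represents x u -> string_op g s u v ->
  represents (obind til x) v.
Proof.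
move=> g_lin stab tilP hu hx huv; case: x hx => [b|] hx /=.
  have [w hw hbw] := tilP b; have eb := represents_wt hu hx.
  have hb : has_weight mu (rep b) by rewrite -eb; apply: rep_weight.
  have := string_op_lin g_lin (-1) hb hu hw huv; rewrite !scaleN1r !(addrC (- _)).
  have hub : has_weight mu (u - rep b) by apply: has_weightB.
  move=> /(qL_string_op g_lin stab hub hx) qvw; rewrite /Defs.represents.
  by have := qLD qvw hbw; rewrite addrA subrK.
by apply/represents_None; apply: (qL_string_op g_lin stab hu _ huv); apply/represents_None.
Qed.

Lemma lattice_stableF s : lattice_stable (Fshift s) s.
Proof. by move=> u v Lu huv; apply: lattice_F Lu huv. Qed.

Lemma lattice_stableE s : lattice_stable (Eshift s) s.
Proof. by move=> u v Lu huv; apply: lattice_E Lu _; apply/kashiwaraE_op; exact: huv. Qed.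

Lemma represents_f s x mu u v : has_weight mu u -> represents x u ->
  string_op (Fshift s) s u v -> represents (f_ s x) v.
Proof.
apply: represents_string_op; [exact: Fshift_lin|exact: lattice_stableF|].
exact: ftilP.
Qed.

Lemma represents_e s x mu u v : has_weight mu u -> represents x u ->
  string_op (Eshift s) s u v -> represents (e_ s x) v.
Proof.
apply: represents_string_op; [exact: Eshift_lin|exact: lattice_stableE|].
by move=> b; have [w hw hbw] := etilP s b; exists w => //; apply/kashiwaraE_op.
Qed.

Lemma pairing_ge0 s mu k v : pairing mu s k -> has_weight mu v -> v != 0 ->
  E s v = 0 -> 0 <= k.
Proof.
move=> hk hv v0 ev; rewrite leNgt; apply: contra v0 => k0; apply/eqP.
by apply: (low_weight_eq0 (n := 1) Vint hk hv ev); lia.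
Qed.

(** The decomposition has v as its only component, in position n; n <= k is the bound demanded by
    [string_dec]. *)
Lemma string_op_divpow g s n mu k v : termwise_linear g -> pairing mu s k ->
  has_weight mu v -> E s v = 0 -> (n%:Z <= k) -> string_op g s (Fd s n v) (g n v).
Proof.
move=> g_lin hk hv ev nk.
exists (mu - simple_root h s *+ n), n.+1, (fun i => if i == n then v else 0).
have g0 := string_op_g0 g_lin; split; last first.
  rewrite big_nat_recr //= eqxx big_nat big1 ?add0r // => i /andP[_ /ltn_eqF ->].
  exact: g0.
split=> [i|i|i|].
- by case: (i =P n); rewrite ?linear0.
- by case: (i =P n) => [->|_]; rewrite ?subrK //; apply: has_weight0.
- case: (i =P n) => [->|_]; last by rewrite eqxx.
  move=> v0; have k0 := pairing_ge0 hk hv v0 ev.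
  by exists `|k|%N; [lia|rewrite subrK hk pmulrn gez0_abs].
- rewrite big_nat_recr //= eqxx big_nat big1 ?add0r // => i /andP[_ /ltn_eqF ->].
  exact: divpow_0.
Qed.

Lemma string_op_ker g s mu v : termwise_linear g -> has_weight mu v -> E s v = 0 ->
  string_op g s v (g 0 v).
Proof.
move=> g_lin hv ev; have [v0|v0] := eqVneq v 0.
  rewrite v0 (string_op_g0 g_lin); exists mu, 0, (fun=> 0); rewrite !big_geq //; split=> //.
  by split=> [n|n|n|]; rewrite ?linear0 ?eqxx ?big_geq //; apply: has_weight0.
have [k hk] := pairing_exists s hv v0; have k0 := pairing_ge0 hk hv v0 ev.
by have := string_op_divpow (n := 0) g_lin hk hv ev k0; rewrite divpow0.
Qed.

Lemma string_opD g s mu u u' v v' : termwise_linear g ->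
  has_weight mu u -> has_weight mu u' ->
  string_op g s u v -> string_op g s u' v' -> string_op g s (u + u') (v + v').
Proof.
by move=> gl hu hu' h1 h2; have := string_op_lin gl 1 hu hu' h1 h2; rewrite !scale1r.
Qed.

(** * Explicit s-strings of length at most two below weights with c_s = 0 *)

Section DepthStrings.

Variables (c : Delta -> nat) (s : Delta).
Hypothesis cs0 : c s = 0.
Let m := depth_pairing c s.

Lemma depth_E_eq0 v : has_weight (depth_weight c) v -> E s v = 0.
Proof. by move=> hv; apply: (iterE_depth_eq0 (n := 1) hv); rewrite cs0. Qed.

Lemma depth_qint_neq0 : [q m]_s != 0.
Proof. by apply: qs_int_neq0; rewrite gt_eqF // depth_pairing_gt0. Qed.

Lemma string_op_depth0 g v : termwise_linear g ->
  has_weight (depth_weight c) v -> string_op g s v (g 0 v).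
Proof. by move=> gl hv; apply: string_op_ker gl hv (depth_E_eq0 hv). Qed.

(** E_s kills v, so on v the Kashiwara operator is F_s itself. *)
Lemma lattice_F_depth v : has_weight (depth_weight c) v -> L v -> L (F s v).
Proof.
move=> hv Lv; apply: lattice_stableF Lv _; rewrite -divpow1.
exact: string_op_depth0 (@Fshift_lin s) hv.
Qed.

Lemma lattice_divpow2_depth v : has_weight (depth_weight c) v -> L v -> L (Fd s 2 v).
Proof.
move=> hv Lv; apply: lattice_stableF (lattice_F_depth hv Lv) _; rewrite -divpow1.
apply: string_op_divpow (@Fshift_lin s) (depth_weightP c s) hv (depth_E_eq0 hv) _.
exact: depth_pairing_gt0.
Qed.

(* v_1 in the string decomposition v = v_0 + F_s v_1 of a vector of weight
   depth_weight (incr c s). *)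
Definition string_top v := [q m]_s^-1 *: E s v.

Section OneStep.
Variable v : V.
Hypothesis hv : has_weight (depth_weight (incr c s)) v.

Lemma has_weight_string_top : has_weight (depth_weight c) (string_top v).
Proof.
apply: has_weightZ; rewrite -[depth_weight c](subrK (simple_root h s)) -depth_weight_incr.
exact: has_weightE.
Qed.

Lemma E_string_top : E s v = [q m]_s *: string_top v.
Proof. by rewrite scalerA divff ?scale1r // depth_qint_neq0. Qed.

Let v0 := v - F s (string_top v).

Let Ev0 : E s v0 = 0.
Proof.
rewrite linearB /= (E_F (depth_weightP c s) has_weight_string_top) E_string_top.
by rewrite (depth_E_eq0 has_weight_string_top) linear0 add0r subrr.
Qed.

Let hv0 : has_weight (depth_weight (incr c s)) v0.
Proof.
by apply: has_weightB => //; rewrite depth_weight_incr; apply/has_weightF/has_weight_string_top.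
Qed.

Lemma string_op_depth1 g : termwise_linear g ->
  string_op g s v (g 0 v0 + g 1 (string_top v)).
Proof.
move=> gl; rewrite -{1}[v](subrK (F s (string_top v))) -/v0.
have hF : has_weight (depth_weight (incr c s)) (F s (string_top v)).
  by rewrite depth_weight_incr; apply/has_weightF/has_weight_string_top.
apply: (string_opD gl hv0 hF); first exact: string_op_ker gl hv0 Ev0.
rewrite -[F s _]divpow1.
apply: (string_op_divpow gl (depth_weightP c s) has_weight_string_top).
  exact: depth_E_eq0 has_weight_string_top.
exact: depth_pairing_gt0.
Qed.

Lemma kashiwaraE_depth1 : string_op (Eshift s) s v (string_top v).
Proof. by have := string_op_depth1 (@Eshift_lin s); rewrite /= add0r divpow0. Qed.

(** The image of v = v_0 + F_s v_1 is F_s v_0 + F_s^(2) v_1, and F_s v_0 = F_s v - [2] F_s^(2)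
    v_1. *)
Lemma kashiwaraF_depth1 : string_op (Fshift s) s v
  (F s v - ([q 2]_s - 1) *: Fd s 2 (string_top v)).
Proof.
have := string_op_depth1 (@Fshift_lin s).
rewrite /Fshift divpow1 /v0 linearB /= -[F s (string_top v)]divpow1 F_divpow.
by rewrite scalerBl scale1r opprB (addrC (Fd s 2 _)) addrA.
Qed.

Hypothesis Lv : L v.

Lemma lattice_string_top : L (string_top v).
Proof. exact: lattice_stableE Lv kashiwaraE_depth1. Qed.

(** F_s v = F_s v_0 + [2] F_s^(2) v_1: plain F_s leaves the lattice at worst by the pole of [2]. *)
Lemma lattice_F_depth1 : exists a b, [/\ L a, L b & F s v = a + [q 2]_s *: b].
Proof.
exists (F s v0), (Fd s 2 (string_top v)); split.
- apply: (lattice_stableF (s := s) (u := v0)).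
    apply: latticeB => //; apply: lattice_F_depth; first exact: has_weight_string_top.
    exact: lattice_string_top.
  by have := string_op_ker (@Fshift_lin s) hv0 Ev0; rewrite /Fshift divpow1.
- apply: lattice_divpow2_depth; first exact: has_weight_string_top.
  exact: lattice_string_top.
- by rewrite -F_divpow divpow1 /v0 linearB /= subrK.
Qed.

End OneStep.

(** For v = v_0 + F_s v_1 + F_s^(2) v_2 the Kashiwara operator gives v_1 + F_s v_2 and then v_2,
    while E_s^2 kills the first two terms and returns a multiple of v_2. *)
Lemma kashiwaraE_depth2 v : has_weight (depth_weight (incr (incr c s) s)) v ->
  exists v' v'', [/\ has_weight (depth_weight (incr c s)) v',
    has_weight (depth_weight c) v'', string_op (Eshift s) s v v',
    string_op (Eshift s) s v' v'' &
    E s (E s v) = ([q m]_s * [q (m - 1)]_s) *: v''].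
Proof.
move=> hv; have e3 : iter 3 (E s) v = 0.
  by apply: iterE_depth_eq0 hv _; rewrite /incr eqxx cs0.
have [a ha] := string_dec_exists hv e3; have [a1 a2 a3 ev] := ha.
have w1 : depth_weight (incr (incr c s) s) + simple_root h s *+ 1 = depth_weight (incr c s).
  by rewrite depth_weight_incr subrK.
have w2 : depth_weight (incr (incr c s) s) + simple_root h s *+ 2 = depth_weight c.
  by rewrite !depth_weight_incr mulr2n addrA !subrK.
have h1 : has_weight (depth_weight (incr c s)) (a 1) by rewrite -w1.
have h2 : has_weight (depth_weight c) (a 2) by rewrite -w2.
have p1 : pairing (depth_weight (incr c s)) s (m - 2).
  by have := depth_weightP (incr c s) s; rewrite depth_pairing_incr A_diag.
have hE : has_weight (depth_weight (incr c s)) (a 1 + F s (a 2)).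
  by apply: has_weightD => //; rewrite depth_weight_incr; apply: has_weightF.
have EE : E s (a 1 + F s (a 2)) = [q m]_s *: a 2.
  by rewrite linearD /= a1 (E_F (depth_weightP c s) h2) a1 linear0 !add0r.
exists (a 1 + F s (a 2)), (a 2); split=> //.
- exists (depth_weight (incr (incr c s) s)), 3%N, a; split; first exact: ha.
  by rewrite !big_nat_recr //= big_geq // !add0r divpow0 divpow1.
- have := kashiwaraE_depth1 hE.
  by rewrite /string_top EE scalerA mulVf ?scale1r ?depth_qint_neq0.
- have -> : E s v = [q (m - 2)]_s *: a 1 + [q (m - 1)]_s *: F s (a 2).
    rewrite ev !big_nat_recr //= big_geq // add0r divpow0 divpow1 !linearD /= a1 add0r.
    rewrite (E_F p1 h1) a1 linear0 add0r.
    by rewrite (E_divpow 1 (depth_weightP c s) h2 (a1 2)) divpow1.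
  rewrite linearD !linearZ /= a1 scaler0 add0r (E_F (depth_weightP c s) h2) a1 linear0.
  by rewrite add0r scalerA mulrC.
Qed.

End DepthStrings.

(** * Crystal operators for two simple roots *)

Section AdjacentRoots.

Variables (c : Delta -> nat) (s t : Delta).
Hypotheses (st : s != t) (d_st : d s = d t) (A_st : A s t = -1).
Hypotheses (cs0 : c s = 0) (ct0 : c t = 0).

Let ts : t != s. Proof. by rewrite eq_sym. Qed.

Let qts : qs d t = qs d s. Proof. by rewrite /qs d_st. Qed.

Let incr0 r r' : r != r' -> incr c r' r = c r.
Proof. by move=> rr'; rewrite /incr eq_sym (negbTE rr') addn0. Qed.

Let depth_pairing_nat : exists2 n : nat, (0 < n)%N & depth_pairing c s = n.
Proof. by have := depth_pairing_gt0 cs0; case: depth_pairing => // n; exists n. Qed.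

(** Let m be the pairing of the weight at depth c with alpha_s^vee. Here f_t is given by F_t, which
    raises this pairing by one, so the s-top of f_t b is [m]/[m+1] times F_t of the s-top of b. *)
Lemma e_f_adjacent_eq_None b : wt b = depth_weight (incr c s) ->
  e_ s (f_ t (Some b : option B)) = None.
Proof.
move=> wb; have hv : has_weight (depth_weight (incr c s)) (rep b).
  by rewrite -wb; apply: rep_weight.
have ct0' : incr c s t = 0 by rewrite incr0.
have cs0' : incr c t s = 0 by rewrite incr0.
have kF := string_op_depth0 ct0' (@Fshift_lin t) hv; rewrite /Fshift divpow1 in kF.
have rF := represents_f hv (represents_rep b) kF.
have hF : has_weight (depth_weight (incr (incr c t) s)) (F t (rep b)).
  have := has_weightF t hv; rewrite !depth_weight_incr; rewrite -!addrA.
  by rewrite (addrC (- simple_root h t)).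
have rE := represents_e hF rF (kashiwaraE_depth1 cs0' hF).
apply: (represents_fun rE); apply/represents_None.
rewrite /string_top depth_pairing_incr A_st opprK E_F_comm //.
have [n n0 nE] := depth_pairing_nat; rewrite (E_string_top cs0) nE linearZ scalerA /=.
have -> : n%:Z + 1 = n.+1 by lia.
apply: qLZ; first by rewrite mulrC; apply: (qint_ratio1 (d_gt0 s)).
apply: (lattice_F_depth ct0 (has_weight_string_top hv)).
apply: (lattice_string_top cs0 hv); exact: rep_lattice.
Qed.

(** The two conditions on z account for the two summands in [lattice_F_depth1]. *)
Let qLF z v : vanishes_at0 z -> vanishes_at0 ([q 2]_s * z) ->
  has_weight (depth_weight (incr c t)) v -> L v -> qL (z *: F t v).
Proof.
move=> vz v2z hv Lv; have [a [b [La Lb ->]]] := lattice_F_depth1 ct0 hv Lv.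
by rewrite scalerDr scalerA qts (mulrC z); apply: qLD; apply: qLZ.
Qed.

(** Let v_1 be the s-top of b and w_1 that of its t-top. The s-top of f_t b is [m+1]/[m+2] F_t v_1 -
    ([2] - 1) [m]/[m+2] F_t^(2) w_1. The second coefficient vanishes at 0. In the first term the
    quotient cancels the pole of [2] coming from F_t, and v_1 contributes a factor q because e_s
    kills b. *)
Lemma e_f_adjacent_preserve b : wt b = depth_weight (incr (incr c s) t) ->
  e_ s (Some b : option B) = None -> e_ s (f_ t (Some b : option B)) = None.
Proof.
move=> wb ebN; have hv : has_weight (depth_weight (incr (incr c s) t)) (rep b).
  by rewrite -wb; apply: rep_weight.
have hv' : has_weight (depth_weight (incr (incr c t) s)) (rep b).
  by move: hv; rewrite !depth_weight_incr addrAC.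
have ct0' : incr c s t = 0 by rewrite incr0.
have cs0' : incr c t s = 0 by rewrite incr0.
have cs0'' : incr (incr c t) t s = 0 by rewrite /incr (negbTE ts) !addn0.
have kF := kashiwaraF_depth1 ct0' hv.
have rF := represents_f hv (represents_rep b) kF.
set w := string_top _ t _ in kF rF.
have hw : has_weight (depth_weight (incr c s)) w by apply: has_weight_string_top.
have Lw : L w by apply: lattice_string_top hv _ => //; apply: rep_lattice.
set v' := _ - _ in kF rF.
have hF : has_weight (depth_weight (incr (incr (incr c t) t) s)) v'.
  have -> : depth_weight (incr (incr (incr c t) t) s) =
            depth_weight (incr (incr c s) t) - simple_root h t.
    by rewrite -depth_weight_incr; apply: eq_depth_weight => r; rewrite /incr; lia.
  apply: has_weightB; first exact: has_weightF.
  apply: has_weightZ; have := has_weight_divpow t 2 hw.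
  by rewrite mulr2n opprD addrA -!depth_weight_incr.
have rE := represents_e hF rF (kashiwaraE_depth1 cs0'' hF).
apply: (represents_fun rE); apply/represents_None.
have qv1 : qL (string_top (incr c t) s (rep b)).
  apply/represents_None; rewrite -ebN; apply: (represents_e hv' (represents_rep b)).
  exact: (kashiwaraE_depth1 cs0' hv').
rewrite /string_top !depth_pairing_incr A_st !opprK /v' linearB linearZ /= E_F_comm //.
rewrite E_divpow_comm //.
rewrite (E_string_top cs0' (rep b)) (E_string_top cs0 w) depth_pairing_incr A_st opprK.
have [n n0 nE] := depth_pairing_nat; rewrite nE.
have -> : n%:Z + 1 = n.+1 by lia.
have -> : n.+1%:Z + 1 = n.+2 by lia.
have hv1 := has_weight_string_top hv'; have hw1 := has_weight_string_top hw.
have Lw1 := lattice_string_top cs0 hw Lw.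
move: (string_top (incr c t) s _) (string_top c s w) qv1 hv1 hw1 Lw1.
move=> v1 w1 [u Lu eu] hv1 hw1 Lw1.
have LD := lattice_divpow2_depth ct0 hw1 Lw1.
rewrite linearZ /= divpow_Z qts; move: (Fd t 2 w1) LD => D2 LD.
rewrite scalerBr !scalerA eu linearZ /= scalerA.
have hu : has_weight (depth_weight (incr c t)) u.
  have -> : u = qvar^-1 *: v1 by rewrite eu scalerA mulVf ?qvar_neq0 ?scale1r.
  exact: has_weightZ.
rewrite mulr_ratio mulr_subr1_ratio; have r1 := qint_ratio1 (d_gt0 s) n.+1.
apply: qLB.
  apply: qLF hu Lu; first by apply: vanishes_qvar; apply: vanishes_regular r1.
  by rewrite mulrCA; apply: vanishes_qvar; apply: (qint2_ratio1 (d_gt0 s)).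
apply: qLZ LD; apply: vanishesB; first exact: (qint2_ratio2 (d_gt0 s)).
exact: (qint_ratio2 (d_gt0 s)).
Qed.

(** Let v_2 and w_2 be the second s-components of b and of its t-top. That of f_t b is [m]/[m+2] F_t
    v_2 - ([2] - 1) [m] [m-1] / ([m+2] [m+1]) F_t^(2) w_2, where [m]/[m+2] vanishes at 0 even after
    multiplication by [2]. *)
Lemma e_e_f_adjacent_eq_None b : wt b = depth_weight (incr (incr (incr c s) s) t) ->
  e_ s (e_ s (f_ t (Some b : option B))) = None.
Proof.
move=> wb; have hv : has_weight (depth_weight (incr (incr (incr c s) s) t)) (rep b).
  by rewrite -wb; apply: rep_weight.
have hv' : has_weight (depth_weight (incr (incr (incr c t) s) s)) (rep b).
  by rewrite (@eq_depth_weight _ (incr (incr (incr c s) s) t)) // => r; rewrite /incr; lia.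
have ct0' : incr (incr c s) s t = 0 by rewrite /incr (negbTE st) !addn0.
have cs0' : incr c t s = 0 by rewrite incr0.
have cs0'' : incr (incr c t) t s = 0 by rewrite /incr (negbTE ts) !addn0.
have kF := kashiwaraF_depth1 ct0' hv.
have rF := represents_f hv (represents_rep b) kF.
set w := string_top _ t _ in kF rF.
have hw : has_weight (depth_weight (incr (incr c s) s)) w by apply: has_weight_string_top.
have Lw : L w by apply: (lattice_string_top ct0' hv); apply: rep_lattice.
set v' := _ - _ in kF rF.
have hF : has_weight (depth_weight (incr (incr (incr (incr c t) t) s) s)) v'.
  have -> : depth_weight (incr (incr (incr (incr c t) t) s) s) =
            depth_weight (incr (incr (incr c t) s) s) - simple_root h t.
    by rewrite -depth_weight_incr; apply: eq_depth_weight => r; rewrite /incr; lia.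
  apply: has_weightB; first exact: has_weightF.
  apply: has_weightZ; have := has_weight_divpow t 2 hw.
  rewrite mulr2n opprD addrA -!depth_weight_incr.
  rewrite (@eq_depth_weight _ (incr (incr (incr (incr c t) s) s) t)) // => r.
  by rewrite /incr; lia.
have [x1 [x2 [hx1 _ kx1 kx2 ex]]] := kashiwaraE_depth2 cs0'' hF.
have rE := represents_e hx1 (represents_e hF rF kx1) kx2.
apply: (represents_fun rE); apply/represents_None.
have [v1 [v2 [_ hv2 kv1 kv2 ev]]] := kashiwaraE_depth2 cs0' hv'.
have [w1 [w2 [_ hw2 kw1 kw2 ew]]] := kashiwaraE_depth2 cs0 hw.
have Lv2 : L v2.
  by apply: (lattice_stableE _ kv2); apply: (lattice_stableE _ kv1); apply: rep_lattice.
have Lw2 : L w2.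
  by apply: (lattice_stableE _ kw2); apply: (lattice_stableE _ kw1).
have eD : E s (E s (Fd t 2 w)) = Fd t 2 (E s (E s w)).
  by rewrite !(E_divpow_comm _ _ st).
move: ex; rewrite /v'; move: (Fd t 2 w) eD => D1 eD.
rewrite !linearB !linearZ /= !(E_F_comm _ st) eD.
have LD := lattice_divpow2_depth ct0 hw2 Lw2.
rewrite ev ew linearZ /= divpow_Z qts; move: (Fd t 2 w2) LD => D2 LD.
rewrite !depth_pairing_incr A_st !opprK.
(* As m is positive, write m = n + 1, so that m - 1 is again a natural number. *)
have [[//|n] _ ->] := depth_pairing_nat.
have -> : n.+1%:Z - 1 = n by lia.
have -> : n.+1%:Z + 1 = n.+2 by lia.
have -> : n.+2%:Z + 1 = n.+3 by lia.
have -> : n.+3%:Z - 1 = n.+2 by lia.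
have -> : n.+2%:Z - 1 = n.+1 by lia.
rewrite scalerN scalerA => /esym/scaled_difference_solve -> //; try exact: qs_int_neq0.
have r2 := qint_ratio2 (d_gt0 s) n.+1; have r2' := qint2_ratio2 (d_gt0 s) n.+1.
apply: qLB; first exact: qLF.
apply: qLZ LD; apply: vanishesM; first exact: vanishesB.
apply: vanishes_regular; exact: (qint_ratio2 (d_gt0 s) n).
Qed.

End AdjacentRoots.

Lemma string_op_weight_E s mu u v : has_weight mu u -> string_op (Eshift s) s u v ->
  has_weight (mu + simple_root h s) v.
Proof.
move=> hu /(string_op_at (@Eshift_lin s) hu)[N [a_ [[_ h2 _ _] ->]]].
apply: has_weight_sum => -[|n] /=; first exact: has_weight0.
by have := has_weight_divpow s n (h2 n.+1); rewrite mulrS !addrA addrK.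
Qed.

Lemma string_op_weight_F s mu u v : has_weight mu u -> string_op (Fshift s) s u v ->
  has_weight (mu - simple_root h s) v.
Proof.
move=> hu /(string_op_at (@Fshift_lin s) hu)[N [a_ [[_ h2 _ _] ->]]].
apply: has_weight_sum => n.
have := has_weight_divpow s n.+1 (h2 n).
by rewrite mulrS opprD (addrC (- simple_root h s)) addrA addrK.
Qed.

Lemma string_op_total g s mu u : has_weight mu u -> exists v, string_op g s u v.
Proof.
move=> hu; have [n [en _]] := Vint s u; exact: string_op_exists hu en.
Qed.

(** * Commutation of the operators of two orthogonal simple roots *)

Section OrthogonalRoots.

Variables (s t : Delta).
Hypotheses (st : s != t) (A_st : A s t = 0) (A_ts : A t s = 0).

Let ts : t != s. Proof. by rewrite eq_sym. Qed.

(** For a_st = 0 the quantum Serre relation has just two terms and says that X_s and X_t commute. *)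
Lemma serre_commute (X : Delta -> {linear V -> V}) v :
  serre A d (fun r => X r) -> X s (X t v) = X t (X s v).
Proof.
move=> /(_ s t st v); rewrite A_st subr0 /=.
rewrite !big_ord_recl big_ord0 /divpow /= /bump /= /qfact big_geq // big_nat1 qint1 //.
rewrite invr1 expr0 addn0 expr1 scaleN1r !scale1r addr0 => /eqP.
by rewrite subr_eq0 => /eqP.
Qed.

Lemma E_E_comm v : E s (E t v) = E t (E s v).
Proof. exact: serre_commute (@Eop_serre _ _ _ _ _ V). Qed.

Lemma F_F_comm v : F s (F t v) = F t (F s v).
Proof. exact: serre_commute (@Fop_serre _ _ _ _ _ V). Qed.

(** T carries a t-string decomposition to one termwise: it commutes with E_t and the powers of F_t,
    and it does not change pairings with alpha_t^vee. *)
Lemma string_op_commute (g : nat -> V -> V) (T : {linear V -> V}) (nu : weight h) :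
  (forall v, E t (T v) = T (E t v)) -> (forall n v, g n (T v) = T (g n v)) ->
  (forall n v, Fd t n (T v) = T (Fd t n v)) ->
  (forall mu v, has_weight mu v -> has_weight (mu + nu) (T v)) ->
  nu (simple_coroot h t) = 0 ->
  forall u v, string_op g t u v -> string_op g t (T u) (T v).
Proof.
move=> TE Tg TF Tw nu0 u v [mu [N [a [[h1 h2 h3 ->] ->]]]].
exists (mu + nu), N, (fun n => T (a n)); split; last first.
  by rewrite linear_sum; apply: eq_bigr => n _; rewrite Tg.
split=> [n|n|n|].
- by rewrite TE h1 linear0.
- by rewrite addrAC; apply: Tw.
- move=> Ta0; have [|m nm hm] := h3 n; first by apply: contraNneq Ta0 => ->; rewrite linear0.
  by exists m => //; rewrite addrAC add_lfunE hm nu0 addr0.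
- by rewrite linear_sum; apply: eq_bigr => n _; rewrite TF.
Qed.

Lemma kashiwaraF_commute_F u v :
  string_op (Fshift t) t u v -> string_op (Fshift t) t (F s u) (F s v).
Proof.
have FdC n w : Fd t n (F s w) = F s (Fd t n w).
  rewrite /divpow linearZ /=; congr (_ *: _); elim: n => //= n ->.
  by rewrite F_F_comm.
apply: (string_op_commute (nu := - simple_root h s)) => //.
- by move=> w; rewrite E_F_comm.
- by move=> n w; apply: FdC.
- by move=> mu w; apply: has_weightF.
- by rewrite opp_lfunE simple_root_coroot A_ts oppr0.
Qed.

Lemma kashiwaraF_commute_E u v :
  string_op (Fshift t) t u v -> string_op (Fshift t) t (E s u) (E s v).
Proof.
have FdC n w : Fd t n (E s w) = E s (Fd t n w) by rewrite E_divpow_comm.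
apply: (string_op_commute (nu := simple_root h s)) => //.
- by move=> w; rewrite E_E_comm.
- by move=> n w; apply: FdC.
- by move=> mu w; apply: has_weightE.
- by rewrite simple_root_coroot A_ts.
Qed.

Lemma kashiwaraF0 : string_op (Fshift t) t 0 0.
Proof.
have := string_op_ker (@Fshift_lin t) (has_weight0 0) (linear0 (E t)).
by rewrite /Fshift divpow_0.
Qed.

Lemma kashiwaraF_commute_divpow n u v :
  string_op (Fshift t) t u v -> string_op (Fshift t) t (Fd s n u) (Fd s n v).
Proof.
move=> huv; have [mu hu] : exists mu, has_weight mu u.
  by have [mu [N [a [ha _]]]] := huv; exists mu; apply: string_dec_weight ha.
have : string_op (Fshift t) t (iter n (F s) u) (iter n (F s) v).
  by elim: n => //= n IHn; apply: kashiwaraF_commute_F.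
have hn := has_weight_iterF s n hu.
move=> hi.
have := string_op_lin (@Fshift_lin t) (qfact n (qs d s))^-1 hn (has_weight0 _) hi kashiwaraF0.
by rewrite !addr0.
Qed.

(* Applying the t-operator to each component of an s-string decomposition of u
   gives an s-string decomposition of its image. *)
Lemma string_op_square g mu nu u v w : termwise_linear g ->
  (forall n a b, string_op (Fshift t) t a b -> string_op (Fshift t) t (g n a) (g n b)) ->
  (forall n a, has_weight (mu + simple_root h s *+ n) a -> has_weight nu (g n a)) ->
  has_weight mu u -> string_op (Fshift t) t u v -> string_op g s u w ->
  exists2 w', string_op (Fshift t) t w w' & string_op g s v w'.
Proof.
move=> gl gC gw hu huv /(string_op_at gl hu)[N [a [[h1 h2 h3 h4] ->]]].
have [b hb] := boolp.choice (fun n => string_op_total (Fshift t) t (h2 n)).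
have sumC (f : nat -> V -> V) nu' :
   (forall n a b, string_op (Fshift t) t a b -> string_op (Fshift t) t (f n a) (f n b)) ->
   (forall n a, has_weight (mu + simple_root h s *+ n) a -> has_weight nu' (f n a)) ->
   string_op (Fshift t) t (\sum_(0 <= n < N) f n (a n)) (\sum_(0 <= n < N) f n (b n)).
  move=> fC fw; elim: (N) => [|k IHk]; first by rewrite !big_geq //; apply: kashiwaraF0.
  rewrite !big_nat_recr //=; apply: (string_opD (@Fshift_lin t) _ _ IHk).
  - by apply: has_weight_sum => n; apply/fw/h2.
  - exact/fw/h2.
  - exact/fC/hb.
exists (\sum_(0 <= n < N) g n (b n)); first exact: (sumC g nu).
exists (mu - simple_root h t), N, b; split=> //; split=> [n|n|n|].
- have := kashiwaraF_commute_E (hb n); rewrite h1 => hz.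
  exact: (string_op_fun (@Fshift_lin t) hz kashiwaraF0).
- by rewrite addrAC; apply: (string_op_weight_F (h2 n) (hb n)).
- move=> bn0; have [|m nm hm] := h3 n.
    apply: contraNneq bn0 => an0; have := hb n; rewrite an0 => hz.
    by rewrite (string_op_fun (@Fshift_lin t) hz kashiwaraF0).
  by exists m => //; rewrite addrAC add_lfunE hm opp_lfunE simple_root_coroot A_st oppr0 addr0.
- apply: (string_op_fun (@Fshift_lin t) huv); rewrite h4.
  apply: (sumC (Fd s) mu); first by move=> n x y; apply: kashiwaraF_commute_divpow.
  by move=> n x /(has_weight_divpow s n); rewrite addrK.
Qed.

(** The commuting square on a representative of x ends in a single vector, which represents both
    sides. *)
Lemma e_f_comm (x : option B) : e_ s (f_ t x) = f_ t (e_ s x).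
Proof.
case: x => [b|//]; have hv := rep_weight b.
have [v kF] := string_op_total (Fshift t) t hv.
have [w kE] := string_op_total (Eshift s) s hv.
have [||w' kF' kE'] :=
  string_op_square (nu := wt b + simple_root h s) (@Eshift_lin s) _ _ hv kF kE.
- move=> [|n] x y hxy; last exact: kashiwaraF_commute_divpow.
  exact: kashiwaraF0.
- move=> [|n] x hx; first exact: has_weight0.
  by have := has_weight_divpow s n hx; rewrite mulrS !addrA addrK.
have rb := represents_rep b.
have r1 := represents_e (string_op_weight_F hv kF) (represents_f hv rb kF) kE'.
have r2 := represents_f (string_op_weight_E hv kE) (represents_e hv rb kE) kF'.
exact: represents_fun r1 r2.
Qed.

Lemma f_f_comm (x : option B) : f_ s (f_ t x) = f_ t (f_ s x).
Proof.
case: x => [b|//]; have hv := rep_weight b.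
have [v kF] := string_op_total (Fshift t) t hv.
have [w kE] := string_op_total (Fshift s) s hv.
have [||w' kF' kE'] :=
  string_op_square (nu := wt b - simple_root h s) (@Fshift_lin s) _ _ hv kF kE.
- by move=> n x y; apply: kashiwaraF_commute_divpow.
- move=> n x /(has_weight_divpow s n.+1).
  by rewrite mulrS opprD (addrC (- simple_root h s)) addrA addrK.
have rb := represents_rep b.
have r1 := represents_f (string_op_weight_F hv kF) (represents_f hv rb kF) kE'.
have r2 := represents_f (string_op_weight_F hv kE) (represents_f hv rb kE) kF'.
exact: represents_fun r1 r2.
Qed.

End OrthogonalRoots.

(** * Non-vanishing, weights and epsilon in the crystal *)

Section Nonvanishing.

Variable s : Delta.

(** A component moved from position n to j + n has pairing k + 2n, and j <= k gives the required j +
    n <= k + 2n. *)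
Lemma string_dec_shift mu k j N a u : pairing mu s k -> j%:Z <= k ->
  string_dec s mu N a u ->
  string_dec s (mu - simple_root h s *+ j) (j + N)
    (fun n => if (n < j)%N then 0 else a (n - j)%N)
    (\sum_(0 <= n < N) Fd s (j + n) (a n)).
Proof.
move=> hk jk [h1 h2 h3 _].
have wE n : (j <= n)%N -> mu - simple_root h s *+ j + simple_root h s *+ n =
                      mu + simple_root h s *+ (n - j).
  by move=> jn; rewrite -{1}(subnKC jn) mulrnDr addrA subrK.
split=> [n|n|n|].
- by case: ifP; rewrite ?linear0.
- case: ltnP => jn; first exact: has_weight0.
  by rewrite wE.
- case: ltnP => jn; first by rewrite eqxx.
  move=> an0; have [m nm hm] := h3 _ an0; exists m; last by rewrite wE.
  have := pairing_inj (pairingD s (n - j) hk) (k' := m); rewrite /pairing hm pmulrn A_diag.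
  by move=> /(_ erefl); lia.
- rewrite [RHS](big_cat_nat (n := j)) ?leq_addr //= [X in _ = X + _]big1_seq ?add0r.
    rewrite [RHS](big_addn 0 (j + N) j) addKn; apply: eq_big_nat => n _.
    by rewrite ltnNge leq_addl addnK addnC.
  by move=> n; rewrite andTb mem_index_iota => /andP[_ ->]; rewrite divpow_0.
Qed.

(** For i <= k the element f_s^i b is represented by the string of b shifted by i places, and e_s
    undoes one shift. Hence f_s^(i+1) b = 0 would force f_s^i b = 0, and finally b = 0. *)
Lemma iter_f_neq0 b k j : pairing (wt b) s k -> j%:Z <= k ->
  iter j (f_ s) (Some b : option B) <> None.
Proof.
move=> hk; have hv := rep_weight b; have [n [en _]] := Vint s (rep b).
have [a ha] := string_dec_exists hv en.
pose v i := \sum_(0 <= m < n) Fd s (i + m) (a m).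
have v0 : v 0 = rep b by case: ha => _ _ _ ->.
pose a' i m := if (m < i)%N then 0 else a (m - i)%N.
have dv i : i%:Z <= k -> string_dec s (wt b - simple_root h s *+ i) (i + n)
    (a' i) (v i).
  by move=> ik; apply: string_dec_shift hk ik ha.
have kF i : i%:Z <= k -> string_op (Fshift s) s (v i) (v i.+1).
  move=> ik; exists (wt b - simple_root h s *+ i), (i + n)%N, (a' i).
  split; first exact: dv ik.
  rewrite /a' [RHS](big_cat_nat (n := i)) ?leq_addr //= [X in _ = X + _]big1_seq ?add0r.
    rewrite [RHS](big_addn 0 (i + n) i) addKn; apply: eq_big_nat => m _.
    by rewrite ltnNge leq_addl addnK /Fshift addSn addnC.
  by move=> m; rewrite andTb mem_index_iota => /andP[_ ->]; rewrite /Fshift divpow_0.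
have kE i : i.+1%:Z <= k -> string_op (Eshift s) s (v i.+1) (v i).
  move=> ik; exists (wt b - simple_root h s *+ i.+1), (i.+1 + n)%N, (a' i.+1).
  split; first exact: dv ik.
  rewrite /a'.
  rewrite [RHS](big_cat_nat (n := i.+1)) ?leq_addr //= [X in _ = X + _]big1_seq ?add0r.
    rewrite [RHS](big_addn 0 (i.+1 + n) i.+1) addKn; apply: eq_big_nat => m _.
    by rewrite ltnNge leq_addl addnK addnS /= addnC.
  move=> m; rewrite andTb mem_index_iota => /andP[_ ->].
  exact: (string_op_g0 (@Eshift_lin s)).
have hr i : i%:Z <= k -> represents (iter i (f_ s) (Some b)) (v i).
  elim: i => [|i IHi] ik; first by rewrite v0; apply: represents_rep.
  have ik' : i%:Z <= k by lia.
  by apply: represents_f (string_dec_weight (dv i ik')) (IHi ik') (kF i ik').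
elim: j => [//|j IHj] jk fN; apply: IHj; first lia.
have := hr j.+1 jk; rewrite fN => rN.
have := represents_e (string_dec_weight (dv _ jk)) rN (kE j jk) => /= rN'.
by apply: represents_fun rN'; apply: hr; lia.
Qed.

End Nonvanishing.

Lemma wt_f s (b b' : B) : f_ s (Some b) = Some b' -> wt b' = wt b - simple_root h s.
Proof.
move=> fb; have hv := rep_weight b; have [v kF] := string_op_total (Fshift s) s hv.
apply: (represents_wt (string_op_weight_F hv kF)); rewrite -fb.
exact: (represents_f hv (represents_rep b) kF).
Qed.

Lemma wt_e s (b b' : B) : e_ s (Some b) = Some b' -> wt b' = wt b + simple_root h s.
Proof.
move=> eb; have hv := rep_weight b; have [v kE] := string_op_total (Eshift s) s hv.
apply: (represents_wt (string_op_weight_E hv kE)); rewrite -eb.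
exact: (represents_e hv (represents_rep b) kE).
Qed.

Lemma e_f_cancel s (x : option B) : f_ s x <> None -> e_ s (f_ s x) = x.
Proof.
case: x => [b|//] /=; case fb: (ftil s b) => [b'|//] _ /=.
by have [/(_ fb)] := ftil_etil s b b'.
Qed.

Lemma iter_e_None s n m (x : option B) : (n <= m)%N ->
  iter n (e_ s) x = None -> iter m (e_ s) x = None.
Proof.
move=> /subnK <- xN; rewrite iterD xN.
by elim: (m - n)%N => //= k ->.
Qed.

(** Otherwise a representative of the result would be a non-zero vector of a weight that does not
    occur in V. *)
Lemma iter_e_depth c s n (b : B) : wt b = depth_weight c -> (c s < n)%N ->
  iter n (e_ s) (Some b) = None.
Proof.
move=> wb cn; case eb: (iter n (e_ s) (Some b)) => [b'|//].
have wb' : wt b' = depth_weight c + simple_root h s *+ n.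
  elim: n b' {cn} eb => [|n IHn] b' /=; first by move=> [<-]; rewrite mulr0n addr0.
  case eb: (iter n (e_ s) (Some b)) => [b''|//] => /wt_e ->.
  by rewrite (IHn _ eb) mulrSr addrA.
have hb' := rep_weight b'; rewrite wb' in hb'.
suff : (n <= c s)%N by rewrite leqNgt cn.
apply: has_weight_depth_le hb'; apply/eqP => r0.
by case: (@rep_notin_qL b'); rewrite r0; apply: qL0.
Qed.

Lemma epsilon_le1 s (b : B) : iter 2 (e_ s) (Some b) = None ->
  exists2 n, epsilon_is s b n & (n <= 1)%N.
Proof.
move=> e2; case e1: (e_ s (Some b)) => [b'|].
  exists 1%N => //; split; first by rewrite -[iter 1 _ _]/(e_ s (Some b)) e1.
  by move=> m; case: (leqP m 1) => // m1 []; apply: iter_e_None e2.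
exists 0%N => //; split=> // m; case: m => // m [].
by apply: (@iter_e_None _ 1).
Qed.

Lemma f_word_cat (u w : seq Delta) (x : option B) :
  f_word (u ++ w) x = f_word u (f_word w x).
Proof. exact: foldr_cat. Qed.

(** * The word f_D f_I *)

Hypothesis A_sym0 : forall s t, A s t = 0 -> A t s = 0.
Hypothesis d_sym : forall s t, (d s)%:Z * A s t = (d t)%:Z * A t s.

Variable pi_rho : B.
Hypothesis wt_pi_rho : wt pi_rho = rho.

Local Notation word w := (f_word w (Some pi_rho)).

Lemma wt_word w b : word w = Some b ->
  wt b = depth_weight (fun s => count_mem s w).
Proof.
elim: w b => [|t w IHw] b /=.
  by move=> [<-]; rewrite wt_pi_rho /depth_weight big1 ?subr0.
case ew: (word w) => [b'|//] /wt_f ->.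
rewrite (IHw _ ew) -depth_weight_incr; apply: eq_depth_weight => s.
by rewrite /incr addnC.
Qed.

Lemma f_word_commute s w (x : option B) :
  {in w, forall t, s != t /\ A s t = 0} -> f_word w (f_ s x) = f_ s (f_word w x).
Proof.
elim: w => //= t w IHw st; have [s_t Ast] := st t (mem_head _ _).
rewrite IHw => [|r rw]; last by apply: st; rewrite inE rw orbT.
by rewrite (f_f_comm s_t Ast (A_sym0 Ast)).
Qed.

Variable I : {set Delta}.
Hypothesis I_simply_laced : forall i j, i \in I -> j \in I -> i != j ->
  A i j = 0 \/ A i j = -1.
Hypothesis I_acyclic : no_cycle A I.
Variables (Rt : {set Delta}) (num : seq Delta).
Hypotheses (RtP : root_choice A I Rt) (numP : numbering A I Rt num).
Variable D : {set Delta}.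
Hypothesis sDI : D \subset I.
Hypothesis lam_dominant :
  dominant (rho *+ 2 - \sum_(i in I) simple_root h i - \sum_(i in D) simple_root h i).

Let num_uniq : uniq num. Proof. by case: numP. Qed.
Let num_I : num =i I. Proof. by case: numP. Qed.

(** * Dominance of lambda in terms of numbers of neighbours *)

Definition neighbours s : {set Delta} := [set t | (t != s) && (A s t != 0)].

(** Within I the diagonal entry contributes 2 and each neighbour -1. *)
Lemma sum_A_neighbours s (S : {set Delta}) : s \in I -> S \subset I ->
  \sum_(t in S) A s t = (2 * (s \in S))%N%:Z - #|S :&: neighbours s|%:Z.
Proof.
move=> sI SI; have -> : #|S :&: neighbours s|%:Z = - \sum_(t in S | t != s) A s t.
  rewrite -natz -sum1_card natr_sum -sumrN [RHS]big_mkcond [LHS]big_mkcond.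
  apply: eq_bigr => t _.
  rewrite !inE; case: (boolP (t \in S)) => //= tS; case: eqVneq => //= ts.
  have st : s != t by rewrite eq_sym.
  by have [->|->] := I_simply_laced sI (subsetP SI t tS) st.
rewrite opprK; case: (boolP (s \in S)) => sS; last first.
  rewrite muln0 add0r; apply: eq_bigl => t.
  by case: eqVneq => [->|]; rewrite ?(negbTE sS) ?andbT.
by rewrite (bigD1 s) //= A_diag.
Qed.

(** The pairing of lambda with alpha_s^vee is the left-over of these neighbour counts after
    subtracting 2, and it is non-negative. *)
Lemma neighbours_dominant s : s \in D ->
  (2 <= #|I :&: neighbours s| + #|D :&: neighbours s|)%N.
Proof.
move=> sD; have sI := subsetP sDI s sD; have [n en] := lam_dominant s.
have e (S : {set Delta}) : (\sum_(i in S) simple_root h i) (simple_coroot h s) =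
   (\sum_(i in S) A s i)%:~R.
  by rewrite sum_lfunE rmorph_sum; apply: eq_bigr => i _; rewrite simple_root_coroot.
have hn : pairing (rho *+ 2 - \sum_(i in I) simple_root h i -
    \sum_(i in D) simple_root h i) s n by rewrite /pairing en pmulrn.
have hp : pairing (rho *+ 2 - \sum_(i in I) simple_root h i -
    \sum_(i in D) simple_root h i) s (1 + 1 - \sum_(i in I) A s i - \sum_(i in D) A s i).
  by rewrite /pairing !add_lfunE !opp_lfunE rhoP !e !intrB intrD.
have := pairing_inj hp hn.
rewrite !sum_A_neighbours // sI sD; lia.
Qed.

(** Gives the pairing met by the second f_s, where u lists the elements of D after s: so far alpha_s
    has been subtracted once. *)
Lemma wt_word_pairing s (u : seq Delta) b :
  s \in I -> s \notin u -> {subset u <= I} -> uniq u ->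
  word (u ++ rev num) = Some b ->
  pairing (wt b) s (#|I :&: neighbours s|%:Z + #|[set t in u] :&: neighbours s|%:Z - 1).
Proof.
move=> sI su uI uu /wt_word ->; have := depth_weightP (fun t => count_mem t (u ++ rev num)) s.
set S := [set t in u]; have SI : S \subset I by apply/subsetP => t; rewrite inE => /uI.
suff -> : depth_pairing (fun t => count_mem t (u ++ rev num)) s =
  1 - \sum_(t in I) A s t - \sum_(t in S) A s t.
  rewrite !sum_A_neighbours // sI inE (negbTE su) muln0 sub0r opprK.
  by congr (pairing _ _ _); lia.
rewrite /depth_pairing -addrA -opprD; congr (_ - _).
rewrite [X in _ = X + _]big_mkcond [X in _ = _ + X]big_mkcond -big_split.
apply: eq_bigr => t _ /=; rewrite count_cat count_rev !count_uniq_mem // num_I inE.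
by do 2!case: (_ \in _); rewrite ?mulr0n ?mulr1n ?addr0 ?add0r.
Qed.

(** * Non-vanishing of the word *)

Lemma word_rev_neq0 n1 n2 : num = n1 ++ n2 -> word (rev n1) <> None.
Proof.
elim/last_ind: n1 n2 => [//|n1 s IHn1] n2; rewrite cat_rcons => en.
rewrite rev_rcons /=; have := IHn1 _ en; case ew: (word (rev n1)) => [b|//] _.
have wb := wt_word ew; have := depth_weightP (fun t => count_mem t (rev n1)) s.
rewrite -wb => hk; apply: (iter_f_neq0 (j := 1) hk).
(* The letter s has not been used yet, so the pairing is positive. *)
apply: depth_pairing_gt0; apply/count_memPn; rewrite mem_rev.
by move: num_uniq; rewrite en uniq_catC /= mem_cat => /andP[]; rewrite negb_or => /andP[].
Qed.

Lemma filter_later s n1 n2 : num = n1 ++ s :: n2 -> let u := [seq i <- n2 | i \in D] in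
  [/\ s \in I, s \notin u, {subset u <= I} & uniq u].
Proof.
move=> en /=; move: num_uniq; rewrite en uniq_catC /= => /andP[sn].
rewrite cat_uniq => /and3P[un2 _ _]; split.
- by rewrite -num_I en mem_cat mem_head orbT.
- by apply: contra sn; rewrite mem_filter mem_cat => /andP[_ ->].
- by move=> t; rewrite mem_filter => /andP[/(subsetP sDI)].
- exact: filter_uniq.
Qed.

Lemma mem_later s t n1 n2 : num = n1 ++ s :: n2 -> t \in n2 -> s != t /\ t \in I.
Proof.
move=> en tn2; split; last by rewrite -num_I en mem_cat in_cons tn2 !orbT.
move: num_uniq; rewrite en cat_uniq /= => /and4P[_ _ sn2 _].
by apply: contraNneq sn2 => ->.
Qed.

Lemma word_split s n1 n2 (u : seq Delta) : num = n1 ++ s :: n2 ->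
  {in u ++ rev n2, forall t, s != t /\ A s t = 0} ->
  word (u ++ rev num) = f_ s (word (u ++ rev n2 ++ rev n1)).
Proof.
move=> -> comm; rewrite rev_cat rev_cons cat_rcons !catA.
by rewrite (f_word_cat (u ++ rev n2) (s :: _)) (f_word_cat (u ++ rev n2)) -f_word_commute.
Qed.

Lemma word_filter_neq0 n1 n2 : num = n1 ++ n2 ->
  word ([seq i <- n2 | i \in D] ++ rev num) <> None.
Proof.
elim: n2 n1 => [|s n2 IHn2] n1 en /=.
  by apply: (word_rev_neq0 (n2 := [::])); rewrite cats0.
have := IHn2 (rcons n1 s); rewrite cat_rcons => /(_ en).
case: ifP => // sD; have [sI su uI uu] := filter_later en.
set u := [seq i <- n2 | i \in D] in su uI uu *.
case ew: (word (u ++ rev num)) => [b|//] _; rewrite /= ew.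
have hk := wt_word_pairing sI su uI uu ew.
have dom := neighbours_dominant sD.
have := subset_leq_card (setSI (neighbours s) sDI) => DI.
have [k0|k0] := ltnP 1 (#|I :&: neighbours s| + #|[set t in u] :&: neighbours s|).
  by apply: (iter_f_neq0 (j := 1) hk); lia.
(* Together with dominance, the failure of positivity leaves exactly one neighbour of s in I. It
   lies in D but not in u, hence not after s in the numbering, so f_s commutes with all later
   factors. *)
have u0 : [set t in u] :&: neighbours s = set0 by apply: cards0_eq; lia.
have eDI : D :&: neighbours s = I :&: neighbours s.
  by apply/eqP; rewrite eqEcard setSI //; lia.
have comm : {in u ++ rev n2, forall t, s != t /\ A s t = 0}.
  move=> t tu; have tn2 : t \in n2.
    by move: tu; rewrite mem_cat mem_rev mem_filter => /orP[/andP[]|].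
  have [st tI] := mem_later en tn2; split=> //; apply/eqP/negPn/negP => Ast.
  have tN : t \in I :&: neighbours s by rewrite !inE tI eq_sym st Ast.
  have tD : t \in D by move: tN; rewrite -eDI inE => /andP[].
  by have := in_set0 t; rewrite -u0 inE (setIP tN).2 inE mem_filter tD tn2.
rewrite (word_split en comm) in ew *.
have n0 : word (u ++ rev n2 ++ rev n1) <> None.
  by move=> wN; rewrite wN in ew.
case ew': (word _) n0 => [b0|//] _; rewrite ew' /= in ew.
(* The pairing after all these factors is 1 + 0 - 1 = 0. With the first f_s moved to the far left
   and removed, it is 2, which leaves room for f_s^2. *)
have wb := wt_f ew; have hk0 : pairing (wt b0) s 2.
  have -> : wt b0 = wt b + simple_root h s *+ 1 by rewrite wb subrK.
  by have := pairingD s 1 hk; rewrite A_diag; congr (pairing _ _ _); lia.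
have /(_ isT) := iter_f_neq0 (j := 2) hk0.
by rewrite -[iter 2 _ _]/(f_ s (ftil s b0)) ew.
Qed.

(** * Bounds on epsilon_s along the word *)

Lemma adjacent_data s t : s \in I -> t \in I -> s != t -> A s t != 0 ->
  [/\ d s = d t, A s t = -1 & A t s = -1].
Proof.
move=> sI tI st Ast; have [/eqP|es] := I_simply_laced sI tI st; first by rewrite (negbTE Ast).
have ts : t != s by rewrite eq_sym.
have et : A t s = -1.
  have [et|//] := I_simply_laced tI sI ts.
  by case/eqP: Ast; apply: A_sym0.
(* With both entries equal to -1, the symmetrizer condition reads d_s = d_t. *)
by split=> //; have := d_sym s t; rewrite es et; lia.
Qed.

Lemma e_f_None_orthogonal s t (x : option B) : s != t -> A s t = 0 ->
  e_ s x = None -> e_ s (f_ t x) = None.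
Proof. by move=> st Ast ex; rewrite (e_f_comm st Ast (A_sym0 Ast)) ex. Qed.

Lemma uniq_num_parts s n1 n2 : num = n1 ++ s :: n2 ->
  [/\ s \notin n1, s \notin n2, uniq n1, uniq n2 & {in n2, forall t, t \notin n1}].
Proof.
move=> en; move: num_uniq; rewrite en cat_uniq /= => /and4P[u1 /norP[s1 h12] s2 u2].
by split=> // t tn2; apply: contra h12 => tn1; apply/hasP; exists t.
Qed.

(** Induction on the factors after the first f_s. An orthogonal f_t preserves the vanishing; an
    adjacent one creates it, since then c_s = 1 and c_t = 0. *)
Lemma e_word_rev_None s n1 n2 a b : num = n1 ++ s :: n2 -> n2 = a ++ b ->
  has (fun t => A s t != 0) a -> e_ s (word (rev a ++ s :: rev n1)) = None.
Proof.
move=> en; have [s1 s2 u1 u2 d12] := uniq_num_parts en.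
have sI : s \in I by rewrite -num_I en mem_cat mem_head orbT.
elim/last_ind: a b => [//|a t IHa] b; rewrite cat_rcons => en2.
rewrite has_rcons rev_rcons /= => hat.
have tn2 : t \in n2 by rewrite en2 mem_cat mem_head orbT.
have [st tI] := mem_later en tn2.
have [Ast|Ast] := eqVneq (A s t) 0.
  by apply: e_f_None_orthogonal => //; apply: (IHa _ en2); rewrite Ast in hat.
have [dst est _] := adjacent_data sI tI st Ast.
case ew: (word (rev a ++ s :: rev n1)) => [x|//].
have ta : t \notin a.
  by move: u2; rewrite en2 cat_uniq => /and3P[_ /norP[]].
have sa : s \notin a by move: s2; rewrite en2 mem_cat => /norP[].
apply: (e_f_adjacent_eq_None (c := fun r => count_mem r (rev a ++ rev n1)) st dst est).
- by apply/count_memPn; rewrite mem_cat !mem_rev negb_or sa s1.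
- by apply/count_memPn; rewrite mem_cat !mem_rev negb_or ta d12.
rewrite (wt_word ew); apply: eq_depth_weight => r.
by rewrite /incr !count_cat /= addnCA addnC.
Qed.

(** The previous lemma covers the factors from I. A further adjacent f_t with t in D is applied at
    c_s = c_t = 1, where it preserves the vanishing of e_s. *)
Lemma e_word_filter_None s n1 n2 a b : num = n1 ++ s :: n2 -> n2 = a ++ b ->
  has (fun t => A s t != 0) n2 -> e_ s (word ([seq i <- b | i \in D] ++ rev num)) = None.
Proof.
move=> en en2 hn2; have [s1 s2 u1 u2 d12] := uniq_num_parts en.
have sI : s \in I by rewrite -num_I en mem_cat mem_head orbT.
elim: b a en2 => [|t b IHb] a en2 /=.
  rewrite en rev_cat rev_cons cat_rcons.
  by apply: (e_word_rev_None en (b := [::])) => //; rewrite cats0.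
have := IHb (rcons a t); rewrite cat_rcons => /(_ en2) eN; case: ifP => // tD /=.
have tn2 : t \in n2 by rewrite en2 mem_cat mem_head orbT.
have [st tI] := mem_later en tn2.
have [Ast|Ast] := eqVneq (A s t) 0; first exact: e_f_None_orthogonal.
have [dst est _] := adjacent_data sI tI st Ast.
set w := _ ++ rev num in eN *; case ew: (word w) => [x|//]; rewrite ew in eN.
have tb : t \notin b by move: u2; rewrite en2 cat_uniq /= => /and4P[].
have sb : s \notin b by move: s2; rewrite en2 mem_cat in_cons => /norP[_ /norP[]].
have cw r : count_mem r w = ((r \in D) && (r \in b) + (r \in I))%N.
  rewrite count_cat count_rev !count_uniq_mem ?filter_uniq ?num_I ?mem_filter //.
  by move: u2; rewrite en2 cat_uniq /= => /and4P[_ _ _].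
(* The base depth forgets the letters s and t, each of which occurs once in [w]. *)
apply: (e_f_adjacent_preserve
  (c := fun r => if (r == s) || (r == t) then 0 else count_mem r w) st dst est) eN.
- by rewrite eqxx.
- by rewrite eqxx orbT.
rewrite (wt_word ew); apply: eq_depth_weight => r; rewrite /incr.
rewrite (eq_sym r s) (eq_sym r t).
have [<-|_] /= := eqVneq s r; first by rewrite cw (negbTE sb) andbF sI eq_sym (negbTE st).
have [<-|_] /= := eqVneq t r; first by rewrite cw (negbTE tb) andbF tI.
by rewrite !addn0.
Qed.

(** Right after the second f_s, e_s cancels it, so a later neighbour of s already settles the claim.
    Otherwise it is produced by an adjacent f_t with t in D before s in the numbering, applied at
    c_s = 2 and c_t = 1. *)
Lemma e_e_word_None s n1 n2 a b : s \in D -> num = n1 ++ s :: n2 -> n1 = a ++ b ->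
  has (fun t => A s t != 0) n2 || has (fun t => (t \in D) && (A s t != 0)) b ->
  e_ s (e_ s (word ([seq i <- b | i \in D] ++ s :: [seq i <- n2 | i \in D] ++ rev num))) = None.
Proof.
move=> sD en; have [s1 s2 u1 u2 d12] := uniq_num_parts en.
have sI : s \in I by rewrite -num_I en mem_cat mem_head orbT.
elim: b a => [|t b IHb] a en1 /=.
  rewrite orbF => hn2; have eN := e_word_filter_None en (erefl : n2 = [::] ++ n2) hn2.
  set x := word _ in eN *; case fx: (f_ s x) => [y|//].
  by rewrite -fx e_f_cancel ?eN // fx.
have := IHb (rcons a t); rewrite cat_rcons => /(_ en1) eN.
have [tD|tD] /= := boolP (t \in D); last exact: eN.
have tn1 : t \in n1 by rewrite en1 mem_cat mem_head orbT.
have st : s != t by apply: contraNneq s1 => ->.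
have tI : t \in I := subsetP sDI t tD.
have [Ast|Ast] /= := eqVneq (A s t) 0.
  move=> /eN; rewrite !(e_f_comm st Ast (A_sym0 Ast)) => ->.
  by [].
move=> _; have [dst est _] := adjacent_data sI tI st Ast.
set w := _ ++ s :: _ in eN *; case ew: (word w) => [x|//].
have tb : t \notin b by move: u1; rewrite en1 cat_uniq /= => /and4P[].
have sb : s \notin b by move: s1; rewrite en1 mem_cat in_cons => /norP[_ /norP[]].
have tn2 : t \notin n2 by apply/negP => /d12; rewrite tn1.
have cw r : count_mem r w =
    ((r \in D) && (r \in b) + ((s == r) + ((r \in D) && (r \in n2) + (r \in I))))%N.
  rewrite count_cat /= count_cat count_rev !count_uniq_mem ?filter_uniq ?num_I ?mem_filter //.
  by move: u1; rewrite en1 cat_uniq /= => /and4P[_ _ _].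
(* The base depth again forgets s and t; in [w] they occur twice and once. *)
apply: (e_e_f_adjacent_eq_None
  (c := fun r => if (r == s) || (r == t) then 0 else count_mem r w) st dst est).
- by rewrite eqxx.
- by rewrite eqxx orbT.
rewrite (wt_word ew); apply: eq_depth_weight => r; rewrite /incr.
rewrite (eq_sym r s) (eq_sym r t).
have [<-|sr] /= := eqVneq s r.
  by rewrite cw (negbTE sb) (negbTE s2) !andbF sI eqxx eq_sym (negbTE st).
have [<-|tr] /= := eqVneq t r.
  by rewrite cw (negbTE tb) (negbTE tn2) !andbF tI (negbTE st).
by rewrite !addn0.
Qed.

Lemma index_earlier s n1 n2 t : num = n1 ++ s :: n2 -> t \in n1 ->
  (index t num < index s num)%N.
Proof.
move=> en tn1; have [s1 _ _ _ _] := uniq_num_parts en.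
by rewrite en !index_cat tn1 (negbTE s1) /= eqxx addn0 index_mem.
Qed.

(** Otherwise all neighbours of s in I precede it and none lies in D, so dominance yields two of
    them. By the numbering, both edges point away from s, giving s two parents in the forest. *)
Lemma has_later_or_dominated s n1 n2 : s \in D -> num = n1 ++ s :: n2 ->
  has (fun t => A s t != 0) n2 || has (fun t => (t \in D) && (A s t != 0)) n1.
Proof.
move=> sD en; apply/negPn/negP => /norP[/hasPn h2 /hasPn h1].
have sI : s \in I := subsetP sDI s sD; have dom := neighbours_dominant sD.
have earlier t : t \in I :&: neighbours s -> t \in n1.
  rewrite !inE -num_I en mem_cat in_cons => /and3P[/or3P[//||/h2 /negPn/eqP ->]].
    by move=> /eqP ->; rewrite eqxx.
  by move=> _; rewrite eqxx.
have D0 : D :&: neighbours s = set0.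
  apply/setP => t; rewrite !inE; apply/negP => /and3P[tD ts Ast].
  have /h1 : t \in n1 by apply: earlier; rewrite !inE (subsetP sDI t tD) ts Ast.
  by rewrite tD Ast.
rewrite D0 cards0 addn0 in dom; have /card_gt1P[t [t' [tN t'N tt']]] := dom.
case/eqP: tt'; have to_parent r : r \in I :&: neighbours s -> towards_root A I Rt s r.
  move=> rN; have := index_earlier en (earlier _ rN); move: rN.
  rewrite !inE => /and3P[rI rs Asr] ind.
  have sr : adj A I s r by rewrite /adj sI rI eq_sym rs Asr.
  have [//|rts] := towards_root_total A_sym0 I_acyclic RtP sr.
  by case: numP => _ _ /(_ _ _ rts); rewrite ltnNge ltnW.
exact: (towards_root_inj A_sym0 I_acyclic RtP (to_parent _ tN) (to_parent _ t'N)).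
Qed.

Lemma rho_dominant_word :
  exists2 x : B, word ([seq i <- num | i \in D] ++ rev num) = Some x &
    wt x = rho *+ 2 - \sum_(i in I) simple_root h i - \sum_(i in D) simple_root h i - rho
    /\ rho_dominant rho x.
Proof.
have := word_filter_neq0 (n1 := [::]) erefl.
case ew: (word _) => [x|//] _; exists x => //; have wx := wt_word ew.
have cw r : count_mem r ([seq i <- num | i \in D] ++ rev num) = ((r \in D) + (r \in I))%N.
  rewrite count_cat count_rev !count_uniq_mem ?filter_uniq ?mem_filter ?num_I //.
  by case: (boolP (r \in D)) => // /(subsetP sDI) ->.
have wxE : wt x = rho *+ 2 - \sum_(i in I) simple_root h i -
    \sum_(i in D) simple_root h i - rho.
  rewrite wx /depth_weight mulr2n [RHS]addrC !addrA addNr add0r -addrA -opprD.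
  congr (_ - _); rewrite [X in _ = X + _]big_mkcond [X in _ = _ + X]big_mkcond -big_split.
  apply: eq_bigr => r _ /=; rewrite cw.
  by do 2!case: (_ \in _); rewrite ?mulr0n ?mulr1n ?addr0 ?add0r.
split=> //; split; first by rewrite wxE subrK.
move=> s; apply: epsilon_le1.
have [sD|sD] := boolP (s \in D); last first.
  (* Outside D the letter s occurs at most once, so applying e_s twice would leave the weights of
     V. *)
  by apply: (iter_e_depth wx); rewrite cw (negbTE sD); case: (s \in I).
have sn : s \in num by rewrite num_I (subsetP sDI).
have [n1 [n2 en]] : exists n1 n2, num = n1 ++ s :: n2.
  by case/splitPr: sn => n1 n2; exists n1, n2.
have := e_e_word_None sD en (erefl : n1 = [::] ++ n1) (has_later_or_dominated sD en).
have -> : [seq i <- n1 | i \in D] ++ s :: [seq i <- n2 | i \in D] ++ rev num =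
          [seq i <- num | i \in D] ++ rev num by rewrite {2}en filter_cat /= sD -catA.
rewrite ew => eN; exact: eN.
Qed.

End WeightModule.

Theorem theorem1p1 (R : realType) (Delta : finType)
    (A : Delta -> Delta -> int) (A_gcm : is_gcm A)
    (d : Delta -> nat) (d_sym : is_symmetrizer A d)
    (h : realization R A)
    (rho : 'Hom(cartan h, R[i]^o))
    (rhoP : forall s : Delta, rho (simple_coroot h s) = 1)
    (V : Uq_module d h)
    (V_int : integrable V) (V_irr : irreducible_module V)
    (V_rho : highest_weight V rho)
    (B : crystal_base V)
    (pi_rho : B) (wt_pi_rho : wt pi_rho = rho)
    (I : {set Delta})
    (I_simply_laced :
       forall i j : Delta, i \in I -> j \in I -> i != j ->
         A i j = 0 \/ A i j = -1)
    (I_acyclic : no_cycle A I)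
    (Rt : {set Delta}) (RtP : root_choice A I Rt)
    (num : seq Delta) (numP : numbering A I Rt num)
    (D : {set Delta}) (sDI : D \subset I) :
  let lam := rho *+ 2 - \sum_(i in I) simple_root h i - \sum_(i in D) simple_root h i in
  dominant lam ->
  exists2 x : B,
    f_word [seq i <- num | i \in D] (f_word (rev num) (Some pi_rho)) = Some x
    & wt x = lam - rho /\ rho_dominant rho x.
Proof.
move=> lam lam_dom.
have [A_diag A_offdiag A_sym0] := A_gcm; have [d_gt0 dA] := d_sym.
rewrite -f_word_cat.
exact: (rho_dominant_word d_gt0 A_diag V_int A_offdiag rhoP V_irr V_rho A_sym0 dA
  wt_pi_rho I_simply_laced I_acyclic RtP numP sDI lam_dom).
Qed.
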